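(* Let $J\in\mathbb R$. There exists a constant $C_5=C_5(J,c,r)<\infty$ such that for every $L$ and every $\alpha:\Lambda_L\to\mathbb R$, $$\mathrm{var}^J_{\Lambda_L}\big(\langle\alpha,h\rangle\big)\le C_5\,\langle\alpha,\alpha\rangle,$$ where $\langle\alpha,h\rangle=\sum_{i\in\Lambda_L}\alpha(i)h_i$ and $\langle\alpha,\alpha\rangle=\sum_{i\in\Lambda_L}\alpha(i)^2$.
   Context: Fix an integer $r\ge1$. For each $k\in\mathbb Z^2$ let $\Psi_k:\mathbb R\to\mathbb R$ satisfy: $\Psi_k\equiv0$ if $\|k\|_1>r$; $\Psi_k=\Psi_{-k}$ and $\Psi_k(x)=\Psi_k(-x)$; $\Psi_k$ is $C^2$; $\Psi_k''\ge0$, and there is $c>0$ such that the translation-invariant random walk on $\mathbb Z^2$ with jump rates $P_c(0,j)=1$ if $\Psi_j''(h)\ge c$ for all $h$ and $0$ otherwise is irreducible. Let $\Lambda_L=[-L,L]^2\cap\mathbb Z^2$. For $J\in\mathbb R$, $$\mu^J_{\Lambda_L}(d\underline h)=\frac1{Z^J_{\Lambda_L}}\exp\Big[-\sum_{\langle ij\rangle\subset\Lambda_L}\Psi_{j-i}(h_i-h_j)-\sum_{\langle ij\rangle:\,i\in\Lambda_L,\,j\notin\Lambda_L}\Psi_{j-i}(h_i)\Big]\prod_{i\in\Lambda_L}\big(dh_i+e^J\delta_0(dh_i)\big),$$ with $\langle ij\rangle$ ranging over pairs of distinct sites with $\|j-i\|_\infty\le r$; $\mathrm{var}^J_{\Lambda_L}$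 is the variance under this measure. *)

(* Defs.v *)
From HB Require Import structures.
From mathcomp Require Import all_boot all_order all_algebra.
From mathcomp Require Import all_classical all_reals all_analysis.
Set Implicit Arguments. Unset Strict Implicit. Unset Printing Implicit Defensive.
Import Order.TTheory GRing.Theory Num.Theory.
Import numFieldNormedType.Exports.
Local Open Scope ring_scope.

Definition site := (int * int)%type.

Definition norm1 (k : site) : nat := (`|k.1| + `|k.2|)%N.
Definition norminf (k : site) : nat := maxn `|k.1| `|k.2|.
Definition site_opp (k : site) : site := (- k.1, - k.2).
Definition site_sub (j i : site) : site := (j.1 - i.1, j.2 - i.2).
Definition site_add (j i : site) : site := (j.1 + i.1, j.2 + i.2).

Definition interval_Z (L : nat) : seq int :=
  [seq (k%:Z - L%:Z) | k <- iota 0 (2 * L).+1].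
Definition Lambda (L : nat) : seq site :=
  [seq (a, b) | a <- interval_Z L, b <- interval_Z L].

Definition offsets (r : nat) : seq site := Lambda r.

(* strict lexicographic order, to count each unordered pair once *)
Definition site_lt (i j : site) : bool :=
  (i.1 < j.1) || ((i.1 == j.1) && (i.2 < j.2)).

Section Model.
Variable R : realType.
Variable Psi : site -> R -> R.
Variable r : nat.

(* Hamiltonian with zero boundary condition outside Lambda_L:
   sum over unordered pairs <ij> in Lambda_L with 0 < ||j-i||_inf <= r,
   plus sum over pairs i in Lambda_L, j notin Lambda_L, ||j-i||_inf <= r. *)
Definition hamiltonian (L : nat) (h : site -> R) : R :=
  \sum_(i <- Lambda L) \sum_(j <- Lambda L |
        site_lt i j && (norminf (site_sub j i) <= r)%N)
      Psi (site_sub j i) (h i - h j)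
  + \sum_(i <- Lambda L) \sum_(k <- offsets r |
        site_add i k \notin Lambda L)
      Psi k (h i).

Definition apriori (J : R) : {measure set (measurableTypeR R) -> \bar R} :=
  measure_add (@lebesgue_measure R)
    (mscale (NngNum (expR_ge0 J)) (@dirac _ (measurableTypeR R) (0 : R) R)).

Definition upd (h : site -> R) (i : site) (x : R) : site -> R :=
  fun j => if j == i then x else h j.

Fixpoint iint (J : R) (s : seq site) (F : (site -> R) -> \bar R)
  (h : site -> R) : \bar R :=
  match s with
  | [::] => F h
  | i :: s' => (\int[apriori J]_x iint J s' F (upd h i x))%E
  end.

(* integral w.r.t. prod_{i in Lambda_L} (dh_i + e^J delta_0(dh_i)),
   of a function of configurations vanishing outside Lambda_L *)
Definition lam_int (J : R) (L : nat) (F : (site -> R) -> \bar R) : \bar R :=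
  iint J (Lambda L) F (fun _ => 0).

Definition gibbs_weight (L : nat) (h : site -> R) : R :=
  expR (- hamiltonian L h).

Definition partition_fn (J : R) (L : nat) : \bar R :=
  lam_int J L (fun h => (gibbs_weight L h)%:E).

Definition gibbs_expect (J : R) (L : nat) (X : (site -> R) -> R) : \bar R :=
  (lam_int J L (fun h => (X h * gibbs_weight L h)%:E)
    / partition_fn J L)%E.

Definition gibbs_var (J : R) (L : nat) (X : (site -> R) -> R) : \bar R :=
  let m := fine (gibbs_expect J L X) in
  gibbs_expect J L (fun h => (X h - m) ^+ 2).

Definition pairing (L : nat) (alpha h : site -> R) : R :=
  \sum_(i <- Lambda L) alpha i * h i.

End Model.

Definition Psi_hyp (R : realType) (r : nat) (Psi : site -> R -> R) : Prop :=
  [/\ (forall k, (r < norm1 k)%N -> forall x, Psi k x = 0),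
      (forall k x, Psi k x = Psi (site_opp k) x),
      (forall k x, Psi k x = Psi k (- x)),
      (forall k, (forall x, derivable (Psi k) x 1)
              /\ (forall x, derivable (derive1 (Psi k)) x 1)
              /\ continuous (derive1 (derive1 (Psi k)))) &
      (forall k x, 0 <= derive1 (derive1 (Psi k)) x)].

(* jump set of the walk P_c: P_c(0,j) = 1 iff Psi_j'' >= c everywhere *)
Definition Pc_step (R : realType) (Psi : site -> R -> R) (c : R) (j : site)
  : Prop := forall x, c <= derive1 (derive1 (Psi j)) x.

(* irreducibility of the translation-invariant walk on Z^2 with these jumps:
   every site is reachable from the origin by a finite path of allowed jumps *)
Definition Pc_irreducible (R : realType) (Psi : site -> R -> R) (c : R)
  : Prop :=
  forall x : site, exists s : seq site,
    (forall j, j \in s -> Pc_step Psi c j) /\ foldr site_add (0, 0) s = x.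

(* Main.v *)
Require Import Defs.
From HB Require Import structures.
From mathcomp Require Import all_boot all_order all_algebra.
From mathcomp Require Import all_classical all_reals all_analysis.
From mathcomp Require Import unstable measurable_realfun finmap.
From mathcomp Require Import ring lra zify.
Import Order.TTheory GRing.Theory Num.Theory.
Import numFieldNormedType.Exports.
Local Open Scope ring_scope.
Local Open Scope classical_set_scope.
Local Open Scope ereal_scope.

(** Expand the product of the measures dh + e^J delta_0 over the set A of pinned
    sites. Irreducibility provides one nonzero step v with Psi_v'' >= c, and only
    the bonds along v are used as strictly convex; all others are merely even and
    convex.

    Let tau_A(x) be the distance from x along v to the first pinned or exterior
    site. Telescoping along lines gives the Poincare inequality
    sum_x d(x)^2 / tau_A(x)^3 <= 2 sum_x (d(x) - d(x+v))^2 for d vanishing on A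
    and off the box. Combined with the midpoint Prekopa-Leindler inequality and
    the symmetry h -> -h, this yields E_A[<alpha,h>^2] <= C sum_x alpha(x)^2 tau_A(x)^3
    in the field pinned on A.

    It remains to bound the mean of tau_A(x)^3 over A. Again by Prekopa-Leindler,
    the height at a site at distance n from a pin has density at least
    sqrt(c / (2 pi n)) at 0, so adding a pin there divides the weight of A by at
    most a constant times sqrt(n). A gap of length at least m can be shortened in
    m ways by a pin at distance at most m from its end; as m beats sqrt(m), long
    gaps are rare, uniformly in the box. *)

(** * The Prekopa-Leindler inequality on the line *)

(** Nothing bounds Psi'' from above, so the density of a height at 0 cannot be bounded below by
    comparing weights pointwise. It is bounded through the decay of the marginal: a nonnegative
    function that is at most its value at 0 times a Gaussian has its integral bounded by that value
    times the Gaussian integral.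

    Using convexity along one direction only reduces every estimate to one dimension. This is
    wasteful (fluctuations of order n at distance n from a pin, hence a cost sqrt(n)), but any cost
    of smaller order than m suffices, and the constants then involve only J and c, whatever the step
    v is.

    The midpoint form of Prekopa-Leindler asks only for measurability and an inequality at
    midpoints. It passes through iterated integrals one site at a time and keeps the strict
    convexity as an explicit factor exp(- (c/4) energy).

    No tail bound for the gaps is needed: the weighted sum of (tau_A(x) + m)^3 over A is finite, and
    its part from long gaps is at most half of the whole, hence can be absorbed. *)

Section PrekopaLeindler.
Context {R : realType}.
Local Notation mu := (@lebesgue_measure R).

Lemma measurable_half_preimage (A : set R) (b : R) :
  measurable A -> measurable [set z : R | A (2 * z - b)%R].
Proof.
move=> mA.
have mf : measurable_fun [set: R] (fun z : R => 2 * z - b)%R.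
  by apply: measurable_funB => //; apply: measurable_funM.
by have := mf measurableT _ mA; rewrite setTI.
Qed.

Lemma lebesgue_measure_half (A : set R) (b : R) : measurable A ->
  mu A = 2%:E * mu [set z : R | A (2 * z - b)%R].
Proof.
move=> mA.
have mf : @measurable_fun _ _ (measurableTypeR R) (measurableTypeR R) setT
    (fun z => 2 * z - b)%R.
  by apply: measurable_funB => //; apply: measurable_funM.
pose f0 : measurableTypeR R -> measurableTypeR R := (fun z => 2 * z - b)%R.
pose nu0 : {measure set (measurableTypeR R) -> \bar R} :=
  @pushforward _ _ (measurableTypeR R) (measurableTypeR R) R mu f0.
pose nu : {measure set (measurableTypeR R) -> \bar R} :=
  mscale (NngNum (ler0n R 2)) (nu0 mf).
suff -> : mu A = nu A by [].
apply: lebesgue_measure_unique => // _ [[x y] _ <-].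
rewrite /nu /nu0 /= /mscale /pushforward /= /f0.
rewrite [X in _ = _ * mu X](_ : _ = `]((x + b) / 2)%R, ((y + b) / 2)%R]%classic); last first.
  by apply/seteqP; split => z /=; rewrite /f0 !in_itv/= => /andP[h1 h2]; apply/andP; split; lra.
rewrite !lebesgue_measure_itv/= !lte_fin.
case: ltP => xy; case: ltP => xy2; rewrite ?mule0 //.
- rewrite -!EFinB -EFinM; congr EFin; by field.
- exfalso; lra.
- exfalso; lra.
Qed.

(** The set [M] stands for the half-sum of [A] and [B], which need not be measurable itself. *)
Lemma brunn_minkowski1 (A B M : set R) (n : R) :
  measurable A -> measurable B -> measurable M ->
  (forall x, A x -> `|x| <= n)%R -> (forall x, B x -> `|x| <= n)%R ->
  A !=set0 -> B !=set0 ->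
  (forall a b, A a -> B b -> M ((a + b) / 2)%R) ->
  mu A + mu B <= 2%:E * mu M.
Proof.
move=> mA mB mM An Bn A0 B0 AB.
have supA : has_sup A.
  by split => //; exists n => x /An; rewrite ler_norml => /andP[].
have infB : has_inf B.
  by split => //; exists (- n)%R => x /Bn; rewrite ler_norml => /andP[].
apply/lee_addgt0Pr => e e0.
have e20 : (0 < e / 2)%R by lra.
have [a Aa aS] := sup_adherent e20 supA.
have [b Bb bI] := inf_adherent e20 infB.
pose p := ((sup A + b) / 2)%R; pose q := ((a + inf B) / 2)%R.
(* Two halved copies of A and B that overlap only near their common endpoint. *)
pose TA := [set z : R | A (2 * z - b)%R].
pose TB := [set z : R | B (2 * z - a)%R].
have mTA : measurable TA by exact: measurable_half_preimage.
have mTB : measurable TB by exact: measurable_half_preimage.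
have TAp z : TA z -> (z <= p)%R.
  move=> Az; have : (2 * z - b <= sup A)%R by apply: ub_le_sup => //; case: supA.
  rewrite /p; lra.
have TBq z : TB z -> (q <= z)%R.
  move=> Bz; have : (inf B <= 2 * z - a)%R by apply: ge_inf => //; case: infB.
  rewrite /q; lra.
have TAM : TA `<=` M.
  by move=> z /AB /(_ Bb); congr M; field.
have TBM : TB `<=` M.
  by move=> z Bz; have := AB _ _ Aa Bz; congr M; field.
pose TB' := TB `&` `]p, +oo[%classic.
have mTB' : measurable TB' by apply: measurableI.
have h1 : mu TA + mu TB' <= mu M.
  rewrite -measureU//; last first.
    apply/seteqP; split => z // -[/TAp h [_]] /=; rewrite in_itv/= andbT => h'.
    lra.
  apply: le_measure; [by apply/mem_set; apply: measurableU|exact/mem_set|].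
  by move=> z [/TAM//|[/TBM]].
(* The overlap lies in [q, p], of length (sup A - a + b - inf B) / 2 < e / 2. *)
have h2 : mu TB <= mu TB' + (e / 2)%:E.
  apply: (@le_trans _ _ (mu (TB' `|` `[q, p]%classic))).
    apply: le_measure; [exact/mem_set|by apply/mem_set; apply: measurableU|].
    move=> z Bz; case: (leP z p) => zp.
      by right => /=; rewrite in_itv/= zp (TBq _ Bz).
    by left; split => //=; rewrite in_itv/= zp.
  apply: (le_trans (measureU2 _ _ _)) => //.
  apply: leeD2l; rewrite /= lebesgue_measure_itv/=; case: ifP => // _.
    by rewrite -EFinB lee_fin /p /q; lra.
  by rewrite lee_fin ltW.
rewrite (lebesgue_measure_half _ b mA) (lebesgue_measure_half _ a mB).
rewrite -/TA -/TB.
apply: (@le_trans _ _ (2%:E * (mu TA + mu TB'  + (e/2)%:E))).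
  rewrite -ge0_muleDr//; apply: lee_wpmul2l => //.
  by rewrite -addeA; apply: leeD2l.
rewrite ge0_muleDr ?adde_ge0 ?lee_fin ?(ltW e20)//; apply: leeD.
  by apply: lee_wpmul2l.
by rewrite -EFinM lee_fin; lra.
Qed.

Lemma layer_cake (f : R -> R) : measurable_fun setT f -> (forall x, 0 <= f x)%R ->
  \int[mu]_x (f x)%:E = \int[mu]_(s in `[0%R, +oo[) mu [set x | (s < f x)%R].
Proof.
move=> mf f0.
transitivity (\int[mu]_x \int[mu]_s (\1_[set s | (0 <= s)%R /\ (s < f x)%R] s)%:E).
  apply: eq_integral => x _.
  have -> : [set s | (0 <= s)%R /\ (s < f x)%R] = `[0%R, f x[%classic.
    by apply/seteqP; split => s /=; rewrite in_itv/= => /andP.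
  rewrite integral_indic//= setIT lebesgue_measure_itv/= lte_fin.
  case: ifPn => [|]; first by rewrite oppr0 adde0.
  by rewrite -leNgt => h; congr EFin; apply/eqP; rewrite eq_le h f0.
have mS : measurable [set p : R * R | (0 <= p.2)%R /\ (p.2 < f p.1)%R].
  have -> : [set p : R * R | (0 <= p.2)%R /\ (p.2 < f p.1)%R] =
    (fun p : R * R => 0 <= p.2)%R @^-1` [set true] `&`
    (fun p : R * R => p.2 < f p.1)%R @^-1` [set true].
    by apply/seteqP; split => p.
  apply: measurableI.
  - have : measurable_fun setT (fun p : R * R => 0 <= p.2)%R.
      exact: measurable_fun_ler.
    by move=> /(_ measurableT [set true]); rewrite setTI; exact.
  - have : measurable_fun setT (fun p : R * R => p.2 < f p.1)%R.
      by apply: measurable_fun_ltr => //; apply: measurableT_comp.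
    by move=> /(_ measurableT [set true]); rewrite setTI; exact.
pose S := [set p : R * R | (0 <= p.2)%R /\ (p.2 < f p.1)%R].
transitivity (\int[mu]_x \int[mu]_s (\1_S (x, s))%:E).
  apply: eq_integral => x _; apply: eq_integral => s _; rewrite !indicE.
  by congr (_%:R)%:E; congr nat_of_bool; apply/idP/idP; rewrite !inE.
rewrite (fubini_tonelli (fun p : measurableTypeR R * measurableTypeR R => (\1_S p)%:E)) /=; last 2 first.
- by apply/measurable_EFinP; apply: measurable_indic.
- by move=> p; rewrite lee_fin.
rewrite [RHS]integral_mkcond; apply: eq_integral => s _; rewrite patchE.
have [s0|s0] := leP 0%R s.
- rewrite mem_set/= ?in_itv/= ?s0// -[in RHS](setIT [set x | _]) -integral_indic//; last first.
    have -> : [set x | (s < f x)%R] = (fun x => (s < f x)%R) @^-1` [set true] by [].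
    have : measurable_fun setT (fun x => (s < f x)%R).
      exact: measurable_fun_ltr.
    by move=> /(_ measurableT [set true]); rewrite setTI; exact.
  apply: eq_integral => x _; congr EFin; rewrite !indicE; congr (nat_of_bool _)%:R.
  by apply/idP/idP => /set_mem => [[_ h]|h]; apply/mem_set.
- rewrite memNset/= ?in_itv/= ?leNgt ?s0//.
  by apply: integral0_eq => x _; rewrite indicE memNset// /S/= => -[]; lra.
Qed.

Lemma measurable_superlevel (f : R -> R) s : measurable_fun setT f ->
  measurable [set x | (s < f x)%R].
Proof.
move=> mf; have : measurable_fun setT (fun x => (s < f x)%R).
  exact: measurable_fun_ltr.
by move=> /(_ measurableT [set true]); rewrite setTI; exact.
Qed.

Lemma measurable_superlevel_measure (f : R -> R) : measurable_fun setT f ->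
  measurable_fun setT (fun s : R => mu [set x | (s < f x)%R]).
Proof.
move=> mf.
have mS : measurable [set p : R * R | (p.1 < f p.2)%R].
  have : measurable_fun setT (fun p : R * R => p.1 < f p.2)%R.
    by apply: measurable_fun_ltr => //; apply: measurableT_comp.
  by move=> /(_ measurableT [set true]); rewrite setTI; exact.
have := @measurable_fun_xsection _ _ _ _ R mu _ mS.
by apply: eq_measurable_fun => s _ /=; congr (mu _); apply/seteqP; split => x;
  [move=> /set_mem|move=> ?; apply/mem_set].
Qed.

(** Midpoints of the superlevel sets of [f] and [g] at height s lie in that of [m]. Since both
    suprema are 1, the two sets are nonempty for every s < 1 and both empty afterwards, so
    [brunn_minkowski1] can be integrated over s. The arithmetic mean obtained is stronger than the
    geometric one. *)
Lemma prekopa_leindler_normalized (f g m : R -> R) (n : R) :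
  measurable_fun setT f -> measurable_fun setT g -> measurable_fun setT m ->
  (forall x, 0 <= f x <= 1)%R -> (forall x, 0 <= g x <= 1)%R -> (forall x, 0 <= m x)%R ->
  (forall x, f x != 0 -> `|x| <= n)%R -> (forall x, g x != 0 -> `|x| <= n)%R ->
  (forall s, s < 1 -> exists x, s < f x)%R -> (forall s, s < 1 -> exists x, s < g x)%R ->
  (forall x y, f x * g y <= m ((x + y) / 2) ^+ 2)%R ->
  \int[mu]_x (f x)%:E + \int[mu]_x (g x)%:E <= 2%:E * \int[mu]_x (m x)%:E.
Proof.
move=> mf mg mm f01 g01 m0 fn gn fs gs fgm.
have f0 x : (0 <= f x)%R by case/andP: (f01 x).
have g0 x : (0 <= g x)%R by case/andP: (g01 x).
rewrite !layer_cake//.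
rewrite -ge0_integralD//; last 2 first.
- apply: measurable_funTS; exact: measurable_superlevel_measure.
- apply: measurable_funTS; exact: measurable_superlevel_measure.
rewrite -ge0_integralZl//; last first.
  by apply: measurable_funTS; exact: measurable_superlevel_measure.
apply: ge0_le_integral => //.
- by move=> s _; rewrite adde_ge0.
- apply: emeasurable_funD; apply: measurable_funTS; exact: measurable_superlevel_measure.
- apply: measurable_funeM; apply: measurable_funTS; exact: measurable_superlevel_measure.
move=> s /=; rewrite in_itv/= andbT => s0.
have [s1|s1] := ltP s 1%R; last first.
  have E (h : R -> R) : (forall x, 0 <= h x <= 1)%R -> [set x | (s < h x)%R] = set0.
    by move=> h01; apply/seteqP; split => x //=; case/andP: (h01 x) => *; lra.
  by rewrite (E f)// (E g)// measure0 adde0 mule_ge0.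
apply: (brunn_minkowski1 _ _ _ n); do ?exact: measurable_superlevel.
- by move=> x /= sx; apply: fn; rewrite gt_eqF//; lra.
- by move=> x /= sx; apply: gn; rewrite gt_eqF//; lra.
- exact: fs.
- exact: gs.
move=> a b /= ha hb; rewrite -(ltr_pXn2r (ltn0Sn 1)) ?nnegrE//.
by apply: lt_le_trans (fgm a b); rewrite expr2 ltr_pM.
Qed.
End PrekopaLeindler.

(** * Prekopa-Leindler without normalisation and boundedness *)

Section PrekopaLeindlerGeneral.
Context {R : realType}.
Local Notation mu := (@lebesgue_measure R).

Let ge_min_l (x y : \bar R) : mine x y <= x.
Proof. by rewrite ge_min lexx. Qed.

Let ge_min_r (x y : \bar R) : mine x y <= y.
Proof. by rewrite ge_min lexx orbT. Qed.

Lemma measurable_fine (f : R -> \bar R) :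
  measurable_fun setT f -> measurable_fun setT (fine \o f).
Proof. by move=> mf; apply: measurableT_comp => //; exact: fine_measurable. Qed.

(** Divide [f] and [g] by their suprema a and b and [m] by sqrt(ab), then return from sums to
    products by the inequality of arithmetic and geometric means. *)
Lemma prekopa_leindler_bounded (f g : R -> R) (m : R -> \bar R) (n : R) :
  measurable_fun setT f -> measurable_fun setT g -> measurable_fun setT m ->
  (forall x, 0 <= f x <= n)%R -> (forall x, 0 <= g x <= n)%R -> (forall x, 0 <= m x) ->
  (forall x, f x != 0 -> `|x| <= n)%R -> (forall x, g x != 0 -> `|x| <= n)%R ->
  (forall x y, (f x * g y)%:E <= m ((x + y) / 2)%R * m ((x + y) / 2)%R) ->
  (\int[mu]_x (f x)%:E) * (\int[mu]_x (g x)%:E) <=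
    (\int[mu]_x m x) * (\int[mu]_x m x).
Proof.
move=> mf mg mm f0n g0n m0 fn gn fgm.
have F0 : 0 <= \int[mu]_x (f x)%:E.
  by apply: integral_ge0 => x _; rewrite lee_fin; case/andP: (f0n x).
have G0 : 0 <= \int[mu]_x (g x)%:E.
  by apply: integral_ge0 => x _; rewrite lee_fin; case/andP: (g0n x).
have M0 : 0 <= \int[mu]_x m x by exact: integral_ge0.
have sup_ex (h : R -> R) : (forall x, 0 <= h x <= n)%R -> has_sup (range h).
  move=> h0n; split; first by exists (h 0%R); exists 0%R.
  by exists n => _ [x _ <-]; case/andP: (h0n x).
have sup_pos (h : R -> R) : (forall x, 0 <= h x <= n)%R ->
    (\int[mu]_x (h x)%:E = 0) \/ (0 < sup (range h))%R.
  move=> h0n; have [hs|hs] := ltP 0%R (sup (range h)); [by right|left].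
  apply: integral0_eq => x _; congr EFin; apply/eqP; rewrite eq_le.
  case/andP: (h0n x) => -> _; rewrite andbT (le_trans _ hs)//.
  by apply: ub_le_sup; [case: (sup_ex _ h0n)|exists x].
have [F00|a0] := sup_pos _ f0n; first by rewrite F00 mul0e mule_ge0.
have [G00|b0] := sup_pos _ g0n; first by rewrite G00 mule0 mule_ge0.
set a := sup _ in a0; set b := sup _ in b0.
have fa x : (f x <= a)%R by apply: ub_le_sup; [case: (sup_ex _ f0n)|exists x].
have gb x : (g x <= b)%R by apply: ub_le_sup; [case: (sup_ex _ g0n)|exists x].
have [->|Moo] := eqVneq (\int[mu]_x m x) +oo; first by rewrite leey.
pose q := Num.sqrt (a * b)%R.
have ab0 : (0 < a * b)%R by rewrite mulr_gt0.
have q0 : (0 < q)%R by rewrite sqrtr_gt0.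
have qq : (q ^+ 2 = a * b)%R by rewrite sqr_sqrtr// ltW.
(* [m] may be infinite; capping it at q keeps the hypothesis because f x * g y <= a * b = q^2. *)
pose c x := mine (m x) q%:E.
have cfin x : c x \is a fin_num.
  rewrite ge0_fin_numE; first by rewrite /c; exact: (le_lt_trans (ge_min_r _ _)) (ltry _).
  by rewrite le_min m0 lee_fin ltW.
pose m' x := (fine (c x) / q)%R.
have c0 x : (0 <= fine (c x))%R.
  by apply: fine_ge0; rewrite le_min m0 lee_fin ltW.
have mc : measurable_fun setT c by apply: measurable_mine.
have mm' : measurable_fun setT m'.
  by apply: measurable_funM => //; apply: measurable_fine.
have key : \int[mu]_x (f x / a)%:E + \int[mu]_x (g x / b)%:E <= 2%:E * \int[mu]_x (m' x)%:E.
  apply: (prekopa_leindler_normalized _ _ _ n) => //.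
  - by apply: measurable_funM.
  - by apply: measurable_funM.
  - move=> x; case/andP: (f0n x) => fx0 _.
    by rewrite divr_ge0 ?(ltW a0)//= ler_pdivrMr// mul1r.
  - move=> x; case/andP: (g0n x) => fx0 _.
    by rewrite divr_ge0 ?(ltW b0)//= ler_pdivrMr// mul1r.
  - by move=> x; rewrite divr_ge0// ltW.
  - by move=> x; rewrite mulf_eq0 negb_or => /andP[/fn].
  - by move=> x; rewrite mulf_eq0 negb_or => /andP[/gn].
  - move=> s s1; have e0 : (0 < a - s * a)%R.
      by rewrite subr_gt0 gtr_pMl.
    have [_ [x _ <-]] := sup_adherent e0 (sup_ex _ f0n).
    rewrite -/a => h; exists x; rewrite ltr_pdivlMr//; lra.
  - move=> s s1; have e0 : (0 < b - s * b)%R.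
      by rewrite subr_gt0 gtr_pMl.
    have [_ [x _ <-]] := sup_adherent e0 (sup_ex _ g0n).
    rewrite -/b => h; exists x; rewrite ltr_pdivlMr//; lra.
  - move=> x y; rewrite /m' /c expr_div_n qq mulf_div ler_pM2r ?invr_gt0//.
    set z := ((x + y) / 2)%R.
    case: (leP (m z) q%:E) => mzq.
      have mz : m z \is a fin_num by rewrite ge0_fin_numE// (le_lt_trans mzq) ?ltry.
      by rewrite -lee_fin expr2 [leRHS]EFinM fineK//; exact: fgm.
    by rewrite /= qq ler_pM//; [case/andP: (f0n x)|case/andP: (g0n y)].
move: key.
have -> : \int[mu]_x (f x / a)%:E = (a^-1)%:E * \int[mu]_x (f x)%:E.
  rewrite -ge0_integralZl_EFin//; first by apply: eq_integral => x _; rewrite -EFinM mulrC.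
  - by move=> x _; rewrite lee_fin; case/andP: (f0n x).
  - exact/measurable_EFinP.
  - by rewrite invr_ge0 ltW.
have -> : \int[mu]_x (g x / b)%:E = (b^-1)%:E * \int[mu]_x (g x)%:E.
  rewrite -ge0_integralZl_EFin//; first by apply: eq_integral => x _; rewrite -EFinM mulrC.
  - by move=> x _; rewrite lee_fin; case/andP: (g0n x).
  - exact/measurable_EFinP.
  - by rewrite invr_ge0 ltW.
have m'm : \int[mu]_x (m' x)%:E <= (q^-1)%:E * \int[mu]_x m x.
  rewrite -ge0_integralZl_EFin//; last by rewrite invr_ge0 ltW.
  apply: ge0_le_integral => //.
  - by move=> x _; rewrite lee_fin divr_ge0// ltW.
  - exact/measurable_EFinP.
  - exact: measurable_funeM.
  move=> x _; rewrite /m' mulrC EFinM; apply: lee_wpmul2l.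
    by rewrite lee_fin invr_ge0 ltW.
  by rewrite fineK// /c ge_min_l.
move=> /le_trans/(_ (lee_wpmul2l _ m'm)) => /(_ (ltac:(by rewrite lee_fin))).
have Mfin : \int[mu]_x m x \is a fin_num by rewrite ge0_fin_numE// ltey.
move: Mfin M0 F0 G0; set M := \int[mu]_x m x; set F := \int[mu]_x _; set G := \int[mu]_x _.
case: M => [M| |]// _; rewrite lee_fin => M0.
have aE : 0 < (a^-1)%:E by rewrite lte_fin invr_gt0.
have bE : 0 < (b^-1)%:E by rewrite lte_fin invr_gt0.
case: F => [F| |]// F0; case: G => [G| |]// G0 h; last first.
- by move: h; rewrite !gt0_muley// -!EFinM leye_eq.
- by move: h; rewrite gt0_muley// -!EFinM addye// leye_eq.
- by move: h; rewrite gt0_muley// -!EFinM addey// leye_eq.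
move: h; rewrite -!EFinM -EFinD !lee_fin in F0 G0 * => h.
have {}h : (F * b + G * a <= 2 * (M * q))%R.
  have -> : (F * b + G * a = (a^-1 * F + b^-1 * G) * (a * b))%R.
    by field; rewrite !gt_eqF.
  have -> : (2 * (M * q) = (2 * (q^-1 * M)) * (a * b))%R.
    by rewrite -qq; field; rewrite gt_eqF.
  by rewrite ler_pM2r.
have h2 : ((F * b + G * a) ^+ 2 <= (2 * (M * q)) ^+ 2)%R.
  rewrite ler_pXn2r// nnegrE; last by rewrite !mulr_ge0// ltW.
  by rewrite addr_ge0// mulr_ge0// ltW.
have h3 : (4 * (F * G) * (a * b) <= 4 * (M * M) * (a * b))%R.
  have -> : (4 * (M * M) * (a * b) = (2 * (M * q)) ^+ 2)%R by rewrite -qq; ring.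
  apply: le_trans h2.
  have -> : ((F * b + G * a) ^+ 2 = 4 * (F * G) * (a * b) + (F * b - G * a) ^+ 2)%R by ring.
  by rewrite lerDl sqr_ge0.
by move: h3; rewrite ler_pM2r// ler_pM2l.
Qed.

(** Multiplication by y = +oo is not continuous at 0, so that case is separate: either some u n is
    nonzero and C = +oo, or u vanishes identically and so does l. *)
Lemma cvge_mulr_le (u : nat -> \bar R) (l y C : \bar R) :
  u @ \oo --> l -> (forall n, 0 <= u n) -> 0 <= y ->
  (forall n, u n * y <= C) -> l * y <= C.
Proof.
move=> ul u0 y0 uC.
have C0 : 0 <= C by apply: le_trans (uC 0%N); rewrite mule_ge0.
have l0 : 0 <= l by apply: (cvge_ge _ ul); exact: nearW.
case: y y0 uC => [y| |] // y0 uC.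
  by apply: (cvge_le _ (cvgeZr _ ul)) => //; apply: nearW.
have [->|ln0] := eqVneq l 0; first by rewrite mul0e.
have [[n un]|nun] := pselect (exists n, u n != 0).
  by have := uC n; rewrite gt0_muley ?leye_eq; [move=> /eqP ->; rewrite leey|rewrite lt0e un u0].
exfalso; move/eqP: ln0; apply; apply/eqP; rewrite eq_le l0 andbT.
apply: (cvge_le _ ul); apply: nearW => n; rewrite leNgt; apply/negP => un.
by apply: nun; exists n; rewrite gt_eqF.
Qed.

(** Height and support are cut at the same n, which gives both bounds of [prekopa_leindler_bounded]
    and a sequence increasing to f. *)
Definition truncation (f : R -> \bar R) (n : nat) (x : R) : R :=
  (fine (mine (f x) n%:R%:E) * \1_`[- n%:R, n%:R] x)%R.

Lemma truncationE (f : R -> \bar R) n x : (forall x, 0 <= f x) ->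
  (truncation f n x)%:E = mine (f x) n%:R%:E * (\1_`[- n%:R, n%:R] x)%:E.
Proof.
move=> f0; rewrite /truncation EFinM fineK//.
rewrite ge0_fin_numE; first exact: (le_lt_trans (ge_min_r _ _)) (ltry _).
by rewrite le_min f0 lee_fin ler0n.
Qed.

Lemma truncation_ge0 (f : R -> \bar R) n x : (forall x, 0 <= f x) ->
  (0 <= truncation f n x)%R.
Proof.
move=> f0; rewrite -lee_fin truncationE// mule_ge0// ?lee_fin//.
by rewrite le_min f0 lee_fin ler0n.
Qed.

Lemma truncation_le (f : R -> \bar R) n x : (forall x, 0 <= f x) ->
  (truncation f n x)%:E <= f x.
Proof.
move=> f0; rewrite truncationE// indicE; case: (_ \in _).
  by rewrite mule1 ge_min_l.
by rewrite mule0.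
Qed.

Lemma measurable_truncation (f : R -> \bar R) n : measurable_fun setT f ->
  measurable_fun setT (truncation f n).
Proof.
move=> mf; apply: measurable_funM; last exact: measurable_indic.
by apply: measurable_fine; apply: measurable_mine.
Qed.

Lemma truncation_homo (f : R -> \bar R) x : (forall x, 0 <= f x) ->
  {homo (fun n => (truncation f n x)%:E) : n k / (n <= k)%N >-> n <= k}.
Proof.
move=> f0 n k nk; rewrite !truncationE//.
have nkR : (n%:R <= k%:R :> R)%R by rewrite ler_nat.
apply: lee_pmul => //.
- by rewrite le_min f0 lee_fin ler0n.
- by rewrite le_min ge_min_l (le_trans (ge_min_r _ _))// lee_fin.
rewrite lee_fin !indicE ler_nat.
case: (boolP (_ \in _)) => // /set_mem /=; rewrite in_itv/= => /andP[h1 h2].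
by rewrite mem_set//= in_itv/=; apply/andP; split; lra.
Qed.

Lemma cvg_truncation (f : R -> \bar R) x : (forall x, 0 <= f x) ->
  (truncation f n x)%:E @[n --> \oo] --> f x.
Proof.
move=> f0.
have N0 : \forall n \near \oo, (`|x| <= n%:R :> R)%R by exact: nbhs_infty_ger.
have E : \forall n \near \oo, (truncation f n x)%:E = mine (f x) n%:R%:E.
  near=> n; rewrite truncationE// indicE mem_set ?mule1//= in_itv/= -ler_norml.
  by near: n.
apply: cvg_trans.
  apply: near_eq_cvg; near=> n; apply/esym; near: n; exact: E.
case: (f x) (f0 x) => [r| |]// r0.
- apply: (cvg_near_cst r%:E); near=> n.
  by apply/min_idPl; rewrite lee_fin; near: n; exact: nbhs_infty_ger.
- apply/cvgeyPge => A; near=> n.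
  rewrite (min_idPr _) ?leey// lee_fin; near: n; exact: nbhs_infty_ger.
Unshelve. all: by end_near. Qed.

Lemma cvg_integral_truncation (f : R -> \bar R) :
  measurable_fun setT f -> (forall x, 0 <= f x) ->
  \int[mu]_x (truncation f n x)%:E @[n --> \oo] --> \int[mu]_x f x.
Proof.
move=> mf f0.
rewrite (_ : \int[mu]_x f x = \int[mu]_x limn (fun n => (truncation f n x)%:E)); last first.
  by apply: eq_integral => x _; apply/esym/cvg_lim => //; exact: cvg_truncation.
apply: cvg_monotone_convergence => //.
- by move=> n; apply/measurable_EFinP; exact: measurable_truncation.
- by move=> n x _; rewrite lee_fin truncation_ge0.
- by move=> x _ n k; exact: truncation_homo.
Qed.

Lemma prekopa_leindler1 (f g m : R -> \bar R) :
  measurable_fun setT f -> measurable_fun setT g -> measurable_fun setT m ->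
  (forall x, 0 <= f x) -> (forall x, 0 <= g x) -> (forall x, 0 <= m x) ->
  (forall x y, f x * g y <= m ((x + y) / 2)%R * m ((x + y) / 2)%R) ->
  (\int[mu]_x f x) * (\int[mu]_x g x) <= (\int[mu]_x m x) * (\int[mu]_x m x).
Proof.
move=> mf mg mm f0 g0 m0 fgm.
have ti0 (h : R -> \bar R) n : (forall x, 0 <= h x) -> 0 <= \int[mu]_x (truncation h n x)%:E.
  by move=> h0; apply: integral_ge0 => x _; rewrite lee_fin truncation_ge0.
(* The two truncation levels are independent, so each limit is taken with the other factor fixed. *)
apply: (cvge_mulr_le _ _ _ _ (cvg_integral_truncation f mf f0)) => [n||n].
- exact: ti0.
- exact: integral_ge0.
rewrite muleC.
apply: (cvge_mulr_le _ _ _ _ (cvg_integral_truncation g mg g0)) => [k||k].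
- exact: ti0.
- exact: ti0.
rewrite muleC.
have tb (h : R -> \bar R) i j x : (forall x, 0 <= h x) -> (i <= j)%N ->
    (0 <= truncation h i x <= j%:R)%R.
  move=> h0 ij; rewrite truncation_ge0//= -lee_fin truncationE//.
  apply: (@le_trans _ _ (mine (h x) i%:R%:E * 1)).
    by apply: lee_wpmul2l; rewrite ?le_min ?h0 ?lee_fin ?ler0n ?indicE ?lern1 ?leq_b1.
  by rewrite mule1 (le_trans (ge_min_r _ _))// lee_fin ler_nat.
have ts (h : R -> \bar R) i j x : (i <= j)%N -> (truncation h i x != 0 -> `|x| <= j%:R)%R.
  move=> ij; rewrite mulf_eq0 negb_or => /andP[_]; rewrite indicE.
  case: (boolP (_ \in _)); rewrite ?eqxx//= => /set_mem /=; rewrite in_itv/= -ler_norml.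
  by move=> /le_trans hx _; apply: hx; rewrite ler_nat.
apply: (@prekopa_leindler_bounded _ _ _ (maxn n k)%:R) => //.
- exact: measurable_truncation.
- exact: measurable_truncation.
- by move=> x; apply: tb; rewrite ?leq_maxl.
- by move=> x; apply: tb; rewrite ?leq_maxr.
- by move=> x; apply: ts; rewrite leq_maxl.
- by move=> x; apply: ts; rewrite leq_maxr.
move=> x y; rewrite EFinM; apply: le_trans (fgm x y).
by apply: lee_pmul; rewrite ?lee_fin ?truncation_ge0 ?truncation_le.
Qed.
End PrekopaLeindlerGeneral.

(** * Iterated integrals with pinned sites *)

Section PinnedIntegral.
Context {R : realType}.
Local Notation mu := (@lebesgue_measure R).
Implicit Types (h : site -> R) (F G : (site -> R) -> \bar R) (s : seq site)
  (A B : {fset site}).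

(* Joint measurability without a sigma-algebra on configurations. *)
Definition nice F := forall d (T : measurableType d) (k : site -> T -> R),
  (forall j, measurable_fun setT (k j)) -> measurable_fun setT (fun t => F (k ^~ t)).

(* The sites of A carry delta_0 and the others Lebesgue measure. *)
Fixpoint pint s A F h : \bar R :=
  match s with
  | [::] => F h
  | i :: s' => if i \in A then pint s' A F (upd h i 0)
               else \int[mu]_x pint s' A F (upd h i x)
  end.

Lemma pint_ge0 s A F h : (forall h, 0 <= F h) -> 0 <= pint s A F h.
Proof.
move=> F0; elim: s h => [|i s IH] h //=.
by case: ifP => _ //; apply: integral_ge0.
Qed.

Lemma nice_upd F i d (T : measurableType d) (k : site -> T -> R) (x : T -> R) :
  nice F -> (forall j, measurable_fun setT (k j)) -> measurable_fun setT x ->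
  measurable_fun setT (fun t => F (upd (k ^~ t) i (x t))).
Proof.
move=> nF mk mx; apply: (nF _ _ (fun j t => if j == i then x t else k j t)) => j.
by case: (j == i).
Qed.

Lemma nice_upd2 F i d (T : measurableType d) (k : site -> T -> R) :
  nice F -> (forall j, measurable_fun setT (k j)) ->
  measurable_fun setT (fun p : T * measurableTypeR R => F (upd (k ^~ p.1) i p.2)).
Proof.
move=> nF mk; apply: (@nice_upd F i _ _ (fun j p => k j p.1) (fun p => p.2)) => //.
- by move=> j; exact: measurableT_comp.
- exact: measurable_snd.
Qed.

Lemma nice_upd1 F h i : nice F ->
  measurable_fun (setT : set (measurableTypeR R)) (fun x => F (upd h i x)).
Proof. by move=> nF; apply: (@nice_upd F i _ _ (fun j _ => h j) id). Qed.

Lemma nice_integral F i : nice F -> (forall h, 0 <= F h) ->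
  nice (fun h => \int[mu]_x F (upd h i x)).
Proof.
move=> nF F0 d T k mk.
apply: (measurable_fun_fubini_tonelli_F
  (fun p : T * measurableTypeR R => F (upd (k ^~ p.1) i p.2))) => //.
exact: (nice_upd2 _ _ _ _ _ nF mk).
Qed.

Lemma nice_pint s A F : nice F -> (forall h, 0 <= F h) -> nice (pint s A F).
Proof.
move=> nF F0; elim: s => [|i s IH] //=; case: (i \in A).
  by move=> d T k mk; apply: nice_upd => //.
by apply: nice_integral => // h; apply: pint_ge0.
Qed.

Lemma integral_apriori (J : R) (f : R -> \bar R) :
  measurable_fun (setT : set (measurableTypeR R)) f -> (forall x, 0 <= f x) ->
  \int[apriori J]_x f x = \int[mu]_x f x + (expR J)%:E * f 0%R.
Proof.
move=> mf f0; rewrite ge0_integral_measure_add//; congr (_ + _).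
by rewrite ge0_integral_mscale// integral_dirac// diracT mul1e.
Qed.

(** [F] may change sign, as it does in the mean of a linear functional; it is split into its
    positive and negative parts. *)
Lemma nice_integral_apriori J F i : nice F ->
  nice (fun h => \int[apriori J]_x F (upd h i x)).
Proof.
move=> nF.
have main G : nice G -> (forall h, 0 <= G h) ->
    nice (fun h => \int[apriori J]_x G (upd h i x)).
  move=> nG G0.
  rewrite (_ : (fun h => _) = (fun h => \int[mu]_x G (upd h i x) +
      (expR J)%:E * G (upd h i 0%R))); last first.
    by apply/funext => h; rewrite integral_apriori//; exact: nice_upd1.
  move=> d T k mk; apply: emeasurable_funD.
    exact: (nice_integral G i nG G0).
  by apply: measurable_funeM; apply: nice_upd.
rewrite (_ : (fun h => _) = (fun h => \int[apriori J]_x (F^\+ (upd h i x)) -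
   \int[apriori J]_x (F^\- (upd h i x)))); last first.
  apply/funext => h; rewrite integralE.
  by congr (_ - _); apply: eq_integral => x _; rewrite ?funeposE ?funenegE.
move=> d T k mk; apply: emeasurable_funB.
- apply: (main F^\+) => // d' T' k' mk'.
  rewrite (_ : (fun t => _) = (fun t => F (k' ^~ t))^\+); last first.
    by apply/funext => t; rewrite !funeposE.
  by apply: measurable_funepos; exact: nF.
- apply: (main F^\-) => // d' T' k' mk'.
  rewrite (_ : (fun t => _) = (fun t => F (k' ^~ t))^\-); last first.
    by apply/funext => t; rewrite !funenegE.
  by apply: measurable_funeneg; exact: nF.
Qed.

Lemma nice_iint J s F : nice F -> nice (iint J s F).
Proof. by move=> nF; elim: s => [|i s IH] //=; exact: nice_integral_apriori. Qed.

Lemma iint_ge0 J s F h : (forall h, 0 <= F h) -> 0 <= iint J s F h.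
Proof. by move=> F0; elim: s h => [|i s IH] h //=; apply: integral_ge0. Qed.

Lemma le_iint J s F G h : nice F -> nice G -> (forall h, 0 <= F h) ->
  (forall h, F h <= G h) -> iint J s F h <= iint J s G h.
Proof.
move=> nF nG F0 FG; elim: s h => [|i s IH] h //=.
apply: ge0_le_integral => //.
- by move=> x _; apply: iint_ge0.
- by apply: nice_upd1; apply: nice_iint.
- by apply: nice_upd1; apply: nice_iint.
Qed.

Lemma le_abse_iint J s F h : nice F ->
  `|iint J s F h| <= iint J s (abse \o F) h.
Proof.
move=> nF.
have nF' : nice (abse \o F).
  by move=> d T k mk; apply: measurableT_comp => //; exact: nF.
elim: s h => [|i s IH] h //=.
apply: (le_trans (le_abse_integral _ _ _)) => //.
  by apply: nice_upd1; apply: nice_iint.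
apply: ge0_le_integral => //.
- by apply: measurableT_comp => //; apply: nice_upd1; apply: nice_iint.
- by apply: nice_upd1; apply: nice_iint.
Qed.

Lemma pint_eq_pins s A B F h : {in s, A =i B} -> pint s A F h = pint s B F h.
Proof.
elim: s h => [|i s IH] h //= AB.
have IH' h' : pint s A F h' = pint s B F h'.
  by apply: IH => j js; apply: AB; rewrite inE js orbT.
rewrite AB ?inE ?eqxx//; case: ifP => _; first exact: IH'.
by apply: eq_integral => x _.
Qed.

Lemma perm_fpowerset_cons (i : site) (S : {fset site}) : i \notin S ->
  perm_eq (fpowerset (i |` S)%fset)
    (fpowerset S ++ [seq (i |` B)%fset | B : {fset site} <- fpowerset S]).
Proof.
move=> iS; apply: uniq_perm; first exact: fset_uniq.
- rewrite cat_uniq fset_uniq/= map_inj_in_uniq ?fset_uniq ?andbT//; last first.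
    move=> A B /=; rewrite !fpowersetE => AS BS /fsetP AB.
    apply/fsetP => j; have := AB j; rewrite !in_fset1U.
    case: (eqVneq j i) => [->|]//= _.
    by rewrite (contraNF ((fsubsetP AS) i) iS) (contraNF ((fsubsetP BS) i) iS).
  apply/hasPn => _ /mapP[B _ ->]; rewrite /= fpowersetE.
  by apply: contra iS => /fsubsetP; apply; rewrite fset1U1.
move=> A; rewrite mem_cat !fpowersetE; apply/idP/orP.
- move=> AS; case: (boolP (i \in A)) => iA; [right|left].
    apply/mapP; exists (A `\ i)%fset; last by rewrite fsetD1K.
    by rewrite fpowersetE fsubDset.
  apply/fsubsetP => j jA; have := fsubsetP AS _ jA; rewrite in_fset1U.
  by case: eqVneq jA iA => [->->|].
- case=> [/fsubset_trans|/mapP[B]]; first by apply; exact: fsubsetU1.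
  by rewrite fpowersetE => BS ->; apply: fsetUS.
Qed.

Lemma iint_pint J s F h : uniq s -> nice F -> (forall h, 0 <= F h) ->
  iint J s F h = \sum_(A <- fpowerset [fset x in s]%fset)
    (expR J ^+ #|` A|)%:E * pint s A F h.
Proof.
move=> us nF F0; elim: s us h => [|i s IH] /=.
  move=> _ h; rewrite (_ : [fset x in [::]]%fset = fset0); last first.
    by apply/fsetP => j; rewrite !inE.
  by rewrite fpowerset0 big_seq_fset1 cardfs0 expr0 mul1e.
move=> /andP[iNs us] h.
have iNS : i \notin [fset x in s]%fset by rewrite inE.
have -> : [fset x in i :: s]%fset = (i |` [fset x in s])%fset.
  by apply/fsetP => j; rewrite !inE.
rewrite (perm_big _ (perm_fpowerset_cons _ _ iNS)) big_cat big_map /=.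
rewrite integral_apriori; last 2 first.
- by apply: nice_upd1; apply: nice_iint.
- by move=> x; apply: iint_ge0.
congr (_ + _).
- under eq_integral do rewrite (IH us).
  rewrite ge0_integral_sum//; last 2 first.
  + move=> A; apply: measurable_funeM; apply: nice_upd1; exact: nice_pint.
  + move=> A x _; rewrite mule_ge0 ?lee_fin ?exprn_ge0 ?expR_ge0//; exact: pint_ge0.
  rewrite big_seq [RHS]big_seq; apply: eq_bigr => A; rewrite fpowersetE => AS.
  rewrite (contraNF ((fsubsetP AS) i) iNS) ge0_integralZl_EFin//.
  + by move=> x _; apply: pint_ge0.
  + by apply: nice_upd1; exact: nice_pint.
- rewrite (IH us) ge0_sume_distrr; last first.
    move=> A _; rewrite mule_ge0 ?lee_fin ?exprn_ge0 ?expR_ge0//; exact: pint_ge0.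
  rewrite big_seq [RHS]big_seq; apply: eq_bigr => A; rewrite fpowersetE => AS.
  rewrite fset1U1 cardfsU1 (contraNF ((fsubsetP AS) i) iNS) /= add1n exprS EFinM muleA.
  congr (_ * _); apply: pint_eq_pins => j js; rewrite in_fset1U.
  by case: eqVneq js iNs => [->->|].
Qed.

(** The configurations that [pint s A] reaches from [h]. Comparing integrands on these alone is what
    brings in that heights vanish at the pins. *)
Definition agree s A h h' :=
  (forall j, j \notin s -> h' j = h j) /\ (forall j, j \in s -> j \in A -> h' j = 0%R).

Lemma agree_cons i s A h h' x : (i \in A -> x = 0%R) ->
  agree s A (upd h i x) h' -> agree (i :: s) A h h'.
Proof.
move=> ix [h1 h2]; split=> j; rewrite inE.
  by rewrite negb_or => /andP[ji js]; rewrite h1// /upd (negbTE ji).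
case: (boolP (j \in s)) => [js _|js]; first exact: h2.
by rewrite orbF => /eqP ji; rewrite h1// ji /upd eqxx; apply: ix.
Qed.

Lemma le_pint s A F G h : nice F -> nice G -> (forall h, 0 <= F h) -> (forall h, 0 <= G h) ->
  (forall h', agree s A h h' -> F h' <= G h') -> pint s A F h <= pint s A G h.
Proof.
move=> nF nG F0 G0; elim: s h => [|i s IH] h /= FG; first by apply: FG.
case: ifPn => iA.
  by apply: IH => h' hh'; apply: FG; apply: agree_cons hh'.
apply: ge0_le_integral => //.
- by move=> x _; apply: pint_ge0.
- by apply: nice_upd1; apply: nice_pint.
- by apply: nice_upd1; apply: nice_pint.
- move=> x _; apply: IH => h' hh'; apply: FG; apply: agree_cons hh'.
  by rewrite (negbTE iA).
Qed.

Lemma pintZ s A F h (c : R) : nice F -> (forall h, 0 <= F h) -> (0 <= c)%R ->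
  pint s A (fun h => c%:E * F h) h = c%:E * pint s A F h.
Proof.
move=> nF F0 c0; elim: s h => [|i s IH] h //=; case: ifP => _; first exact: IH.
under eq_integral do rewrite IH.
rewrite ge0_integralZl_EFin//; first by move=> x _; apply: pint_ge0.
by apply: nice_upd1; apply: nice_pint.
Qed.

Lemma pintD s A F G h : nice F -> nice G -> (forall h, 0 <= F h) -> (forall h, 0 <= G h) ->
  pint s A (fun h => F h + G h) h = pint s A F h + pint s A G h.
Proof.
move=> nF nG F0 G0; elim: s h => [|i s IH] h //=; case: ifP => _; first exact: IH.
under eq_integral do rewrite IH.
by rewrite ge0_integralD//; try (by move=> x _; apply: pint_ge0);
  apply: nice_upd1; apply: nice_pint.
Qed.

Lemma upd_comm h i j x y : i != j -> upd (upd h i x) j y = upd (upd h j y) i x.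
Proof.
move=> ij; apply/funext => k; rewrite /upd.
by case: (eqVneq k j) => [->|]//; rewrite eq_sym (negbTE ij).
Qed.

Lemma pint_swap i j s A F h : i != j -> nice F -> (forall h, 0 <= F h) ->
  pint (i :: j :: s) A F h = pint (j :: i :: s) A F h.
Proof.
move=> ij nF F0 /=.
have nP : nice (pint s A F) by exact: nice_pint.
have E x y : pint s A F (upd (upd h i x) j y) = pint s A F (upd (upd h j y) i x).
  by congr pint; exact: upd_comm.
case: (i \in A); case: (j \in A).
- exact: E.
- by apply: eq_integral => x _; exact: E.
- by apply: eq_integral => x _; exact: E.
transitivity (\int[mu]_y \int[mu]_x pint s A F (upd (upd h i x) j y)); last first.
  by apply: eq_integral => y _; apply: eq_integral => x _; exact: E.
pose f (p : measurableTypeR R * measurableTypeR R) :=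
  pint s A F (upd (upd h i p.1) j p.2).
have mf : measurable_fun setT f.
  apply: (nice_upd _ j _ _ (fun k p => upd h i p.1 k) snd nP) => [k|].
    by rewrite /upd; case: (k == i); [exact: measurable_fst|exact: measurable_cst].
  exact: measurable_snd.
have f0 p : 0 <= f p by exact: pint_ge0.
exact: (fubini_tonelli (m1 := mu) (m2 := mu) f mf f0).
Qed.

(** Serves to make [y] the outermost variable, so that its marginal density appears. *)
Lemma pint_move s1 s2 y A F h : y \notin s1 -> nice F -> (forall h, 0 <= F h) ->
  pint (s1 ++ y :: s2) A F h = pint (y :: s1 ++ s2) A F h.
Proof.
move=> ys nF F0; elim: s1 ys h => [|i s IH] //; rewrite inE negb_or => /andP[yi ys] h.
rewrite [RHS]pint_swap//.
rewrite [LHS]/= [RHS]/=; case: ifP => iA; first by rewrite IH.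
by apply: eq_integral => x _; rewrite IH.
Qed.

Lemma integral_opp (f : R -> \bar R) :
  measurable_fun (setT : set (measurableTypeR R)) f -> (forall x, 0 <= f x) ->
  \int[mu]_x f (- x)%R = \int[mu]_x f x.
Proof.
move=> mf f0.
have mN : measurable_fun (setT : set (measurableTypeR R)) (-%R : _ -> measurableTypeR R).
  exact: oppr_measurable.
have := @ge0_integral_pushforward _ _ (measurableTypeR R) (measurableTypeR R) R _ mN mu setT f.
rewrite preimage_setT => <- //.
by apply: eq_measure_integral => B mB _; rewrite -[RHS]lebesgue_measureN.
Qed.

Definition oppc h : site -> R := fun j => (- h j)%R.

Lemma oppc_upd h i x : oppc (upd h i x) = upd (oppc h) i (- x)%R.
Proof. by apply/funext => j; rewrite /oppc /upd; case: ifP. Qed.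

Lemma pint_oppc s A F h : nice F -> (forall h, 0 <= F h) ->
  pint s A (F \o oppc) h = pint s A F (oppc h).
Proof.
move=> nF F0; elim: s h => [|i s IH] h //=; case: ifP => iA.
  by rewrite IH oppc_upd oppr0.
under eq_integral do rewrite IH oppc_upd.
apply: (integral_opp (fun x => pint s A F (upd (oppc h) i x))).
  by apply: nice_upd1; apply: nice_pint.
by move=> x; apply: pint_ge0.
Qed.

Definition midc h1 h2 : site -> R := fun j => ((h1 j + h2 j) / 2)%R.

Lemma midc_upd h1 h2 i x y :
  midc (upd h1 i x) (upd h2 i y) = upd (midc h1 h2) i ((x + y) / 2)%R.
Proof. by apply/funext => j; rewrite /midc /upd; case: ifP. Qed.

(** Induction on the sites: the claim for the remaining sites is exactly the hypothesis of the
    one-dimensional inequality at the first. At a pinned site both heights are 0, and so is their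
    midpoint. *)
Lemma pint_prekopa_leindler s A F G M h1 h2 :
  nice F -> nice G -> nice M ->
  (forall h, 0 <= F h) -> (forall h, 0 <= G h) -> (forall h, 0 <= M h) ->
  (forall h1' h2', agree s A h1 h1' -> agree s A h2 h2' ->
    F h1' * G h2' <= M (midc h1' h2') * M (midc h1' h2')) ->
  pint s A F h1 * pint s A G h2 <=
    pint s A M (midc h1 h2) * pint s A M (midc h1 h2).
Proof.
move=> nF nG nM F0 G0 M0; elim: s h1 h2 => [|i s IH] h1 h2 /= FGM.
  by apply: FGM.
case: ifPn => iA.
  have := IH (upd h1 i 0%R) (upd h2 i 0%R); rewrite midc_upd addr0 mul0r; apply.
  by move=> h1' h2' a1 a2; apply: FGM; [apply: agree_cons a1|apply: agree_cons a2].
apply: prekopa_leindler1.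
- by apply: nice_upd1; apply: nice_pint.
- by apply: nice_upd1; apply: nice_pint.
- by apply: nice_upd1; apply: nice_pint.
- by move=> x; apply: pint_ge0.
- by move=> x; apply: pint_ge0.
- by move=> x; apply: pint_ge0.
move=> x y; rewrite -midc_upd; apply: IH => h1' h2' a1 a2.
by apply: FGM; [apply: agree_cons a1|apply: agree_cons a2]; rewrite (negbTE iA).
Qed.

End PinnedIntegral.

(** * Discrete Poincare inequality along lines *)

Section RealSums.
Local Open Scope ring_scope.
Context {R : realType}.

Lemma ler_sum_inj (T1 T2 : eqType) (r1 : seq T1) (r2 : seq T2) (f : T1 -> T2)
    (W : T2 -> R) :
  uniq r1 -> uniq r2 -> {in r1 &, injective f} -> (forall x, x \in r1 -> f x \in r2) ->
  (forall y, 0 <= W y) -> \sum_(x <- r1) W (f x) <= \sum_(y <- r2) W y.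
Proof.
move=> u1 u2 finj fr W0; rewrite -(big_map f xpredT W).
rewrite [leRHS](bigID (mem (map f r1))) /=.
rewrite [X in _ <= X + _](_ : _ = \sum_(y <- map f r1) W y).
  by rewrite lerDl sumr_ge0.
rewrite -big_filter; apply: perm_big; apply: uniq_perm.
- exact: filter_uniq.
- by rewrite map_inj_in_uniq.
- move=> y; rewrite mem_filter /=; apply/andP/idP => [[]//|yf]; split=> //.
  by have /mapP[x xr ->] := yf; exact: fr.
Qed.

Lemma le_sum_term (T : eqType) (s : seq T) (P : pred T) (F : T -> R) x :
  x \in s -> P x -> (forall y, 0 <= F y) -> F x <= \sum_(y <- s | P y) F y.
Proof.
move=> xs Px F0; rewrite (perm_big _ (perm_to_rem xs)) big_cons Px lerDl.
exact: sumr_ge0.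
Qed.

(** Cauchy-Schwarz against the constant sequence 1. *)
Lemma sqr_sum_le n (a : nat -> R) :
  (\sum_(k < n) a k) ^+ 2 <= n%:R * \sum_(k < n) a k ^+ 2.
Proof.
elim: n => [|n IH]; first by rewrite !big_ord0 expr0n mul0r.
rewrite !big_ord_recr /=.
have [n0|n0] := posnP n; first by rewrite {IH}n0 !big_ord0 !add0r mul1r.
rewrite -natr1; move: IH; set S := \sum_(k < n) a k; set Q := \sum_(k < n) a k ^+ 2.
set x := a n; set m := n%:R => IH.
have m0 : 0 < m :> R by rewrite ltr0n.
have h : 2 * S * x <= Q + m * x ^+ 2.
  rewrite -(ler_pM2l m0); apply: (@le_trans _ _ (S ^+ 2 + (m * x) ^+ 2)).
    rewrite -subr_ge0 (_ : _ - _ = (S - m * x) ^+ 2) ?sqr_ge0//; ring.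
  by rewrite mulrDr lerD// (_ : m * (m * x ^+ 2) = (m * x) ^+ 2) //; ring.
rewrite (_ : (S + x) ^+ 2 = S ^+ 2 + x ^+ 2 + 2 * S * x); last by ring.
rewrite (_ : (m + 1) * (Q + x ^+ 2) = m * Q + x ^+ 2 + (Q + m * x ^+ 2)); last by ring.
by rewrite lerD// lerD.
Qed.

Lemma sum_inv_sqr_le n : \sum_(k < n) (k.+1%:R ^+ 2)^-1 <= 2 :> R.
Proof.
(* The correction term makes the induction telescope. *)
suff h : \sum_(k < n.+1) (k.+1%:R ^+ 2)^-1 <= 2 - n.+1%:R^-1 :> R.
  apply: (@le_trans _ _ (\sum_(k < n.+1) (k.+1%:R ^+ 2)^-1 : R)).
    by rewrite big_ord_recr /= lerDl invr_ge0 sqr_ge0.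
  by rewrite (le_trans h)// gerBl invr_ge0.
elim: n => [|n IH].
  by rewrite big_ord1 expr1n invr1; lra.
rewrite big_ord_recr /=; apply: (le_trans (lerD IH (lexx _))).
set x := n.+1%:R; rewrite (_ : n.+2%:R = x + 1); last by rewrite /x natr1.
have x0 : 0 < x :> R by rewrite ltr0n.
rewrite -subr_ge0.
have -> : 2 - (x + 1)^-1 - (2 - x^-1 + ((x + 1) ^+ 2)^-1) = (x * (x + 1) ^+ 2)^-1 :> R.
  by field; rewrite !gt_eqF// addr_gt0.
by rewrite invr_ge0 mulr_ge0 ?sqr_ge0 ?ltW.
Qed.

(** The function f - c x^2 / 2 is convex, and the parallelogram identity for c x^2 / 2 produces the
    surplus. It is applied with c = 0 for a general bond and c > 0 for bonds along v. *)
Lemma midpoint_convex (f : R -> R) (c : R) :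
  (forall x, derivable f x 1) -> (forall x, derivable (derive1 f) x 1) ->
  (forall x, c <= derive1 (derive1 f) x) ->
  forall a b, 2 * f ((a + b) / 2) + c / 4 * (a - b) ^+ 2 <= f a + f b.
Proof.
move=> df ddf fc.
suff main a b : a <= b -> 2 * f ((a + b) / 2) + c / 4 * (a - b) ^+ 2 <= f a + f b.
  move=> a b; case: (leP a b) => [|/ltW] ab; first exact: main.
  by rewrite addrC [leRHS]addrC -opprB sqrrN addrC [a + b]addrC; apply: main.
move=> ab.
pose g x := f x - c / 2 * x ^+ 2.
pose g1 x := derive1 f x - c * x.
have dg (x : R) : is_derive x (1 : R) g (g1 x : R).
  have H : is_derive x (1 : R) f (derive1 f x : R) by rewrite derive1E; apply: derivableP.
  have -> : g = f - (c / 2) \*: (@id R * @id R).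
    by apply/funext => y; rewrite /g expr2.
  by apply: is_derive_eq; rewrite /g1 /GRing.scale /=; field.
have dg1 (x : R) : is_derive x (1 : R) g1 (derive1 (derive1 f) x - c : R).
  have H : is_derive x (1 : R) (derive1 f) (derive1 (derive1 f) x : R).
    by rewrite [derive1 (derive1 f) x]derive1E; apply: derivableP.
  have -> : g1 = derive1 f - c \*: (@id R) by [].
  by apply: is_derive_eq; rewrite /GRing.scale /= mulr1.
have Dg : 'D_1 g = g1 by apply/funext => x; apply: derive_val.
have gab : g ((a + b) / 2) <= (g a + g b) / 2.
  have t1 : 2^-1 <= 1 :> R by lra.
  have t0 : 0 <= 2^-1 :> R by lra.
  have cg x : {for x, continuous g}.
    by apply: differentiable_continuous; apply/derivable1_diffP; have [] := dg x.
  have := @second_derivative_convex R g a b _ _ _ _ _ (Itv01 t0 t1) ab.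
  rewrite !convRE /= /onem Dg.
  have -> : 2^-1 * a + (1 - 2^-1) * b = (a + b) / 2 :> R by field.
  have -> : 2^-1 * g a + (1 - 2^-1) * g b = (g a + g b) / 2 :> R by field.
  apply.
  - by move=> x _; rewrite (@derive_val _ _ _ _ _ _ _ (dg1 x)) subr_ge0.
  - exact: (cvg_at_left_filter (cg b)).
  - exact: (cvg_at_right_filter (cg a)).
  - by move=> x _; have [] := dg x.
  - by move=> x _; have [] := dg1 x.
move: gab; rewrite /g => gab.
have -> : c / 4 * (a - b) ^+ 2 =
  c / 2 * a ^+ 2 + c / 2 * b ^+ 2 - c * ((a + b) / 2) ^+ 2 by field.
lra.
Qed.
End RealSums.

(** * Lines in the box, gap lengths and the energy along a direction *)

Section Lattice.
Local Open Scope ring_scope.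

Lemma mem_interval_Z L (a : int) : (a \in interval_Z L) = (- L%:Z <= a <= L%:Z).
Proof.
apply/mapP/idP => [[k]|aL].
  by rewrite mem_iota => kL ->; lia.
by exists (absz (a + L%:Z)); rewrite ?mem_iota; lia.
Qed.

Lemma mem_Lambda L (x : site) :
  (x \in Lambda L) = (- L%:Z <= x.1 <= L%:Z) && (- L%:Z <= x.2 <= L%:Z).
Proof.
case: x => a b; rewrite -!mem_interval_Z; apply/allpairsP/andP => [[[p q] /= [? ? [-> ->]]]|[]].
  by [].
by move=> ? ?; exists (a, b).
Qed.

Lemma uniq_Lambda L : uniq (Lambda L).
Proof.
have uI : uniq (interval_Z L).
  by rewrite map_inj_uniq ?iota_uniq// => i j; lia.
by apply: allpairs_uniq => // -[a b] [a' b'] _ _ [-> ->].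
Qed.

Definition ray (v x : site) (k : nat) : site :=
  (x.1 + k%:Z * v.1, x.2 + k%:Z * v.2).

Lemma ray0 v x : ray v x 0 = x.
Proof. by case: x => a b; rewrite /ray !mul0r !addr0. Qed.

Lemma ray1 v x : ray v x 1 = site_add x v.
Proof. by rewrite /ray !mul1r. Qed.

Lemma rayD v x j k : ray v (ray v x j) k = ray v x (j + k).
Proof. by rewrite /ray PoszD /= !mulrDl !addrA. Qed.

Lemma ray_injl v k : injective (ray v ^~ k).
Proof. by case=> a b [a' b'] [/addIr -> /addIr ->]. Qed.

Lemma ray_injr v x : v != (0, 0) -> injective (ray v x).
Proof.
case: v => p q; rewrite xpair_eqE negb_and /ray /= => v0 j k [/addrI h1 /addrI h2].
case/orP: v0 => n0.
- by have /eqP := mulIf n0 h1; rewrite eqz_nat => /eqP.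
- by have /eqP := mulIf n0 h2; rewrite eqz_nat => /eqP.
Qed.

Definition span L := (2 * L).+1.

(** The first nonzero coordinate of [v] is at least 1, so after [span L] steps that coordinate has
    grown by at least the number of sites on a side. *)
Lemma ray_out L v x : site_lt (0, 0) v -> x \in Lambda L ->
  ray v x (span L) \notin Lambda L.
Proof.
rewrite !mem_Lambda /site_lt /ray /span /= => v0 xL; apply/negP.
case/orP: v0 => [v1|/andP[/eqP v1 v2]]; nia.
Qed.

Section Tau.
Variables (L : nat) (v : site).
Hypothesis v0 : site_lt (0, 0) v.

Definition pinned (A : {fset site}) (x : site) : bool :=
  (x \notin Lambda L) || (x \in A).

(* The number of steps along v from x to the first site that is pinned or
   outside the box. *)
Definition tau (A : {fset site}) (x : site) : nat :=
  find (fun k => pinned A (ray v x k)) (iota 0 (span L)).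

Lemma has_pinned A x : x \in Lambda L ->
  (tau A x <= span L)%N /\ pinned A (ray v x (tau A x)).
Proof.
move=> xL; rewrite /tau.
set s := iota _ _; set a := fun k => _.
case: (boolP (has a s)) => h.
  have := h; rewrite has_find size_iota => h'; split; first exact: ltnW.
  by have := nth_find 0%N h; rewrite nth_iota.
(* When nothing is found, [find] returns the length [span L], and after that many steps the ray is
   outside the box. *)
rewrite (hasNfind h) size_iota; split => //.
by rewrite /pinned ray_out.
Qed.

Lemma pinned_tau A x : x \in Lambda L -> pinned A (ray v x (tau A x)).
Proof. by case/(has_pinned A). Qed.

Lemma tau_le A x : x \in Lambda L -> (tau A x <= span L)%N.
Proof. by case/(has_pinned A). Qed.

Lemma before_tau A x k : x \in Lambda L -> (k < tau A x)%N -> ~~ pinned A (ray v x k).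
Proof.
move=> xL kt; have kN := leq_trans kt (tau_le A _ xL).
by have := before_find 0%N kt; rewrite nth_iota// => ->.
Qed.

Lemma before_tau_mem A x k : x \in Lambda L -> (k < tau A x)%N -> ray v x k \in Lambda L.
Proof. by move=> xL /(before_tau _ _ _ xL); rewrite negb_or negbK => /andP[]. Qed.

Lemma tau_eq A x n : x \in Lambda L -> pinned A (ray v x n) ->
  (forall k, (k < n)%N -> ~~ pinned A (ray v x k)) -> tau A x = n.
Proof.
move=> xL pn bn; apply/eqP; rewrite eqn_leq; apply/andP; split; rewrite leqNgt; apply/negP => h.
  by move: (before_tau _ _ _ xL h); rewrite pn.
by move: (bn _ h); rewrite pinned_tau.
Qed.

End Tau.

Section Energy.
Context {R : realType}.
Variables (L : nat) (v : site).
Hypothesis v0 : site_lt (0, 0) v.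
Implicit Types d : site -> R.

(** The bond by which a line leaves the box is included, since a path to the first pin may end with
    it. *)
Definition energy d : R := \sum_(x <- Lambda L) (d x - d (ray v x 1)) ^+ 2.

Lemma energy_ge0 d : 0 <= energy d.
Proof. by apply: sumr_ge0 => x _; exact: sqr_ge0. Qed.

Lemma sqr_le_path d x n : d (ray v x n) = 0 ->
  d x ^+ 2 <= n%:R * \sum_(k < n) (d (ray v x k) - d (ray v x k.+1)) ^+ 2.
Proof.
move=> dn.
have -> : d x = \sum_(k < n) (d (ray v x k) - d (ray v x k.+1)).
  rewrite -(big_mkord xpredT (fun k => d (ray v x k) - d (ray v x k.+1))).
  rewrite (telescope_sumr_eq (fun k => - d (ray v x k))) //.
    by rewrite dn ray0 oppr0 sub0r opprK.
  by move=> k _; rewrite opprK addrC.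
exact: (sqr_sum_le n (fun k => d (ray v x k) - d (ray v x k.+1))).
Qed.

Let v_neq0 : v != (0, 0).
Proof.
by apply/eqP => E; move: v0; rewrite E /site_lt /= ltxx.
Qed.

Lemma sqr_le_energy d x n : d (ray v x n) = 0 ->
  (forall k, (k < n)%N -> ray v x k \in Lambda L) ->
  d x ^+ 2 <= n%:R * energy d.
Proof.
move=> dn xL; apply: (le_trans (sqr_le_path _ _ _ dn)); apply: ler_wpM2l => //.
rewrite -(big_mkord xpredT (fun k => (d (ray v x k) - d (ray v x k.+1)) ^+ 2)).
under eq_bigr do rewrite -addn1 -rayD.
apply: (ler_sum_inj _ _ _ _ (ray v x) (fun y => (d y - d (ray v y 1)) ^+ 2)).
- exact: iota_uniq.
- exact: uniq_Lambda.
- by move=> j k _ _; exact: ray_injr.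
- by move=> k; rewrite mem_index_iota => /andP[_]; exact: xL.
- by move=> y; exact: sqr_ge0.
Qed.

(** For a path of length t, telescoping and Cauchy-Schwarz give d(x)^2 <= t times the sum of its
    squared increments. After division by t^3 the k-th increment has weight 1/t^2 <= 1/(k+1)^2, as k
    < t. For fixed k the shift by k steps is injective, so the total is at most the energy times the
    sum of 1/(k+1)^2. The cube is what makes this sum converge. *)
Lemma weighted_poincare A d : (forall x, pinned L A x -> d x = 0) ->
  \sum_(x <- Lambda L) d x ^+ 2 / (tau L v A x)%:R ^+ 3 <= 2 * energy d.
Proof.
move=> dA.
pose D y := (d y - d (ray v y 1)) ^+ 2.
have D0 y : 0 <= D y by exact: sqr_ge0.
pose G x k : R := if ray v x k \in Lambda L then (k.+1%:R ^+ 2)^-1 * D (ray v x k) else 0.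
have G0 x k : 0 <= G x k by rewrite /G; case: ifP => // _; rewrite mulr_ge0// invr_ge0 sqr_ge0.
have step x : x \in Lambda L -> d x ^+ 2 / (tau L v A x)%:R ^+ 3 <= \sum_(k < span L) G x k.
  move=> xL; set t := tau L v A x.
  have tL : (t <= span L)%N by exact: tau_le.
  (* At a pinned site the distance is 0 and the quotient is 0 by the convention for inverses. *)
  have [->|t0] := posnP t; first by rewrite expr0n invr0 mulr0 sumr_ge0.
  have tR : 0 < t%:R :> R by rewrite ltr0n.
  apply: (@le_trans _ _ (\sum_(k < t) G x k)); last first.
    rewrite -!(big_mkord xpredT (G x)) [leRHS](big_cat_nat _ (n := t))//= lerDl.
    exact: sumr_ge0.
  have := sqr_le_path d x t (dA _ (pinned_tau _ _ v0 _ _ xL)).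
  move=> h; rewrite ler_pdivrMr ?exprn_gt0//; apply: (le_trans h).
  rewrite mulr_sumr mulr_suml; apply: ler_sum => k _.
  rewrite /G (before_tau_mem _ _ v0 A)// /D rayD addn1.
  set w := (_ - _) ^+ 2; have w0 : 0 <= w by exact: sqr_ge0.
  have k0 : 0 < k.+1%:R :> R by rewrite ltr0n.
  rewrite mulrAC; apply: ler_wpM2r => //.
  rewrite mulrC ler_pdivlMr ?exprn_gt0// [leRHS]exprS; apply: ler_wpM2l; first exact: ltW.
  by rewrite ler_pXn2r ?nnegrE ?ler0n ?ler_nat.
rewrite big_seq; apply: (le_trans (ler_sum _ step)); rewrite -big_seq exchange_big /=.
apply: (@le_trans _ _ (\sum_(k < span L) (k.+1%:R ^+ 2)^-1 * energy d)); last first.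
  by rewrite -mulr_suml ler_wpM2r ?energy_ge0 ?sum_inv_sqr_le.
apply: ler_sum => k _.
rewrite -big_mkcond /= -mulr_sumr; apply: ler_wpM2l; first by rewrite invr_ge0 sqr_ge0.
rewrite -big_filter.
apply: (ler_sum_inj _ _ _ _ (ray v ^~ k) D) => //.
- by rewrite filter_uniq// uniq_Lambda.
- exact: uniq_Lambda.
- by move=> x y _ _; exact: ray_injl.
- by move=> x; rewrite mem_filter => /andP[].
Qed.

End Energy.
End Lattice.

(** * Convexity of the Hamiltonian and the pinned fields *)

Section Hamiltonian.
Local Open Scope ring_scope.
Context {R : realType}.
Variables (r : nat) (Psi : site -> R -> R) (c : R) (v : site).
Hypothesis HPsi : Psi_hyp r Psi.
Hypothesis c0 : 0 < c.
Hypothesis v0 : site_lt (0, 0) v.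
Hypothesis Hv : Pc_step Psi c v.
Implicit Types h : site -> R.

Lemma interaction_convex k a b : 2 * Psi k ((a + b) / 2) <= Psi k a + Psi k b.
Proof.
case: HPsi => _ _ _ /(_ k)[d1 [d2 _]] /(_ k) d3.
by have := midpoint_convex (Psi k) 0 d1 d2 d3 a b; rewrite !mul0r addr0.
Qed.

Lemma interaction_strictly_convex a b :
  2 * Psi v ((a + b) / 2) + c / 4 * (a - b) ^+ 2 <= Psi v a + Psi v b.
Proof.
case: HPsi => _ _ _ /(_ v)[d1 [d2 _]] _.
exact: (midpoint_convex (Psi v) c d1 d2 Hv a b).
Qed.

(** Beyond the range the potential vanishes and its second derivative cannot reach c > 0. Hence the
    bonds along [v] do occur in the Hamiltonian. *)
Lemma norm1_step : (norm1 v <= r)%N.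
Proof.
rewrite leqNgt; apply/negP => vr; case: HPsi => /(_ v vr) P0 _ _ _ _.
have := Hv 0; have -> : Psi v = cst 0 by apply/funext.
have -> : derive1 (cst 0 : R -> R) = cst 0 by apply/funext => x; rewrite derive1_cst.
by rewrite derive1_cst leNgt c0.
Qed.

Lemma norminf_step : (norminf v <= r)%N.
Proof.
apply: leq_trans norm1_step; rewrite /norminf /norm1 geq_max.
by rewrite leq_addr leq_addl.
Qed.

(** Extended by 0 because the boundary terms of [hamiltonian] put height 0 outside the box, whatever
    the configurations are there. *)
Definition diffc L h1 h2 : site -> R :=
  fun j => if j \in Lambda L then h1 j - h2 j else 0.

(** Every term has a nonnegative convexity defect, [T] inside the box and [U] at its boundary. For
    each site i only the defect of the bond from i to i + v is kept, of type [T] or [U] according to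
    whether i + v is in the box. *)
Lemma hamiltonian_midpoint L h1 h2 :
  2 * hamiltonian Psi r L (midc h1 h2) + c / 4 * energy L v (diffc L h1 h2) <=
  hamiltonian Psi r L h1 + hamiltonian Psi r L h2.
Proof.
pose T i j := Psi (site_sub j i) (h1 i - h1 j) + Psi (site_sub j i) (h2 i - h2 j)
  - 2 * Psi (site_sub j i) (midc h1 h2 i - midc h1 h2 j).
pose U i k := Psi k (h1 i) + Psi k (h2 i) - 2 * Psi k (midc h1 h2 i).
have T0 i j : 0 <= T i j.
  rewrite subr_ge0.
  rewrite (_ : midc h1 h2 i - _ = ((h1 i - h1 j) + (h2 i - h2 j)) / 2); last first.
    by rewrite /midc; field.
  exact: interaction_convex.
have U0 i k : 0 <= U i k by rewrite subr_ge0 interaction_convex.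
have E : hamiltonian Psi r L h1 + hamiltonian Psi r L h2 - 2 * hamiltonian Psi r L (midc h1 h2) =
  \sum_(i <- Lambda L) (\sum_(j <- Lambda L | site_lt i j && (norminf (site_sub j i) <= r)%N) T i j
    + \sum_(k <- offsets r | site_add i k \notin Lambda L) U i k).
  rewrite /hamiltonian big_split /= /T /U.
  under [X in _ = X + _]eq_bigr do rewrite sumrB big_split -mulr_sumr.
  under [X in _ = _ + X]eq_bigr do rewrite sumrB big_split -mulr_sumr.
  rewrite !sumrB !big_split -!mulr_sumr /=; ring.
rewrite -lerBrDl E /energy mulr_sumr.
rewrite big_seq [leRHS]big_seq; apply: ler_sum => i iL.
rewrite ray1 /diffc iL; case: ifPn => ivL.
- apply: (@le_trans _ _ (T i (site_add i v))).
    have vE : site_sub (site_add i v) i = v.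
      by rewrite [RHS]surjective_pairing /site_sub /site_add /=; congr pair; ring.
    rewrite /T vE lerBrDl; apply: le_trans (interaction_strictly_convex _ _).
    rewrite le_eqVlt; apply/orP; left; apply/eqP.
    by congr (_ + _ * _ ^+ 2); [congr (_ * Psi _ _)|]; rewrite /midc; field.
  apply: ler_wpDr; first exact: sumr_ge0.
  apply: (le_sum_term _ _ _ (T i)) => //.
  have -> : site_sub (site_add i v) i = v.
    by rewrite [RHS]surjective_pairing /site_sub /site_add /=; congr pair; ring.
  (* As [v] is lexicographically positive, (i, i + v) is the order in which [hamiltonian] counts
     this bond. *)
  rewrite norminf_step andbT; move: v0; rewrite /site_lt /site_add /=; lia.
- apply: (@le_trans _ _ (U i v)).
    rewrite subr0 /U lerBrDl; exact: interaction_strictly_convex.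
  apply: ler_wpDl; first exact: sumr_ge0.
  apply: (le_sum_term _ _ _ (U i)) => //.
  have := norminf_step; rewrite /norminf geq_max /offsets mem_Lambda; lia.
Qed.
End Hamiltonian.

(** * Moments in the field with a fixed pinned set *)

Section PinnedGibbs.
Context {R : realType}.
Variables (r : nat) (Psi : site -> R -> R) (c : R) (v : site).
Hypothesis HPsi : Psi_hyp r Psi.
Hypothesis c0 : (0 < c)%R.
Hypothesis v0 : site_lt (0, 0)%R v.
Hypothesis Hv : Pc_step Psi c v.
Local Notation mu := (@lebesgue_measure R).
Local Notation w L := (gibbs_weight Psi r L).
Local Notation zeroc := ((fun=> 0%R) : site -> R).
Implicit Types h : site -> R.

Lemma measurable_interaction k : measurable_fun setT (Psi k).
Proof.
case: HPsi => _ _ _ /(_ k)[d1 _] _.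
apply: continuous_measurable_fun => x.
by apply: differentiable_continuous; apply/derivable1_diffP.
Qed.

Lemma nice_gibbs L (f : (site -> R) -> R) :
  (forall d (T : measurableType d) (k : site -> T -> R),
    (forall j, measurable_fun setT (k j)) -> measurable_fun setT (fun t => f (k ^~ t))) ->
  nice (fun h => (f h * w L h)%:E).
Proof.
move=> mf d T k mk; apply/measurable_EFinP; apply: measurable_funM; first exact: mf.
rewrite /gibbs_weight; apply: measurableT_comp; first exact: measurable_expR.
apply: measurable_funN; rewrite /hamiltonian; apply: measurable_funD.
- apply: measurable_sum => i; under eq_fun do rewrite big_mkcond.
  apply: measurable_sum => j; case: (site_lt i j && _) => //.
  apply: measurableT_comp; first exact: measurable_interaction.
  exact: measurable_funB.
- apply: measurable_sum => i; under eq_fun do rewrite big_mkcond.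
  apply: measurable_sum => j; case: (site_add i j \notin _) => //.
  apply: measurableT_comp => //; exact: measurable_interaction.
Qed.

Lemma nice_weight L : nice (fun h => (w L h)%:E).
Proof.
have := nice_gibbs L (fun=> 1%R).
rewrite (_ : (fun h => (1 * w L h)%:E) = (fun h => (w L h)%:E)); last first.
  by apply/funext => h; rewrite mul1r.
by apply => *; exact: measurable_cst.
Qed.

Lemma measurable_pairing L (alpha : site -> R) d (T : measurableType d) (k : site -> T -> R) :
  (forall j, measurable_fun setT (k j)) ->
  measurable_fun setT (fun t => pairing L alpha (k ^~ t)).
Proof. by move=> mk; apply: measurable_sum => i; apply: measurable_funM. Qed.

Lemma weight_ge0 L h : 0 <= (w L h)%:E.
Proof. by rewrite lee_fin expR_ge0. Qed.

Lemma hamiltonian_oppc L h : hamiltonian Psi r L (oppc h) = hamiltonian Psi r L h.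
Proof.
case: HPsi => _ _ even _ _; rewrite /hamiltonian; congr (_ + _)%R.
- apply: eq_bigr => i _; apply: eq_bigr => j _.
  by rewrite /oppc -opprB opprK [in RHS]even; congr (Psi _ _); ring.
- by apply: eq_bigr => i _; apply: eq_bigr => j _; rewrite -even.
Qed.

Lemma weight_midpoint L h1 h2 :
  (w L h1 * w L h2 <= w L (midc h1 h2) ^+ 2 * expR (- (c / 4 * energy L v (diffc L h1 h2))))%R.
Proof.
rewrite /gibbs_weight -expRM_natl -!expRD ler_expR.
have := hamiltonian_midpoint r Psi c v HPsi c0 v0 Hv L h1 h2; lra.
Qed.

Lemma mul_le_sqr_ereal (x y : \bar R) : 0 <= x -> 0 <= y -> x * x <= y * y -> x <= y.
Proof.
move=> x0 y0; apply: contraTT; rewrite -!ltNge => yx.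
have yfin : y \is a fin_num by rewrite ge0_fin_numE// (lt_le_trans yx)// leey.
by apply: lte_pmul.
Qed.

Definition pinned_partition L A := pint (Lambda L) A (fun h => (w L h)%:E) zeroc.

Lemma zeroc_oppc : oppc zeroc = zeroc.
Proof. by apply/funext => j; rewrite /oppc oppr0. Qed.

Lemma zeroc_midc : midc zeroc zeroc = zeroc.
Proof. by apply/funext => j; rewrite /midc addr0 mul0r. Qed.

Lemma agree_pinned L A h1 h2 :
  agree (Lambda L) A zeroc h1 -> agree (Lambda L) A zeroc h2 ->
  forall x, pinned L A x -> diffc L h1 h2 x = 0%R.
Proof.
move=> [_ a1] [_ a2] x; rewrite /pinned /diffc; case: ifP => //= xL xA.
by rewrite a1// a2// subrr.
Qed.

Lemma pairing_diffc L alpha h1 h2 :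
  (pairing L alpha h1 - pairing L alpha h2 =
    \sum_(x <- Lambda L) alpha x * diffc L h1 h2 x)%R.
Proof.
rewrite /pairing -sumrB big_seq [RHS]big_seq; apply: eq_bigr => x xL.
by rewrite /diffc xL mulrBr.
Qed.

(** Sitewise t alpha d <= (2/c) t^2 alpha^2 tau^3 + (c/8) d^2 / tau^3. The first terms sum to at
    most 1, and the factor 2 of [weighted_poincare] turns c/8 into the available c/4. *)
Lemma pairing_le_energy L A alpha (t : R) h1 h2 :
  agree (Lambda L) A zeroc h1 -> agree (Lambda L) A zeroc h2 ->
  (t ^+ 2 * (2 / c * \sum_(x <- Lambda L) alpha x ^+ 2 * (tau L v A x)%:R ^+ 3) <= 1)%R ->
  (t * (pairing L alpha h1 - pairing L alpha h2) <=
    1 + c / 4 * energy L v (diffc L h1 h2))%R.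
Proof.
move=> a1 a2 ht; rewrite pairing_diffc.
have P := weighted_poincare L v v0 A _ (agree_pinned _ _ _ _ a1 a2).
set d := diffc L h1 h2 in P *; set E := energy L v d in P *.
apply: (@le_trans _ _ (t ^+ 2 * (2 / c * \sum_(x <- Lambda L) alpha x ^+ 2 * (tau L v A x)%:R ^+ 3)
   + c / 8 * \sum_(x <- Lambda L) d x ^+ 2 / (tau L v A x)%:R ^+ 3)%R); last first.
  apply: lerD => //; rewrite (_ : (c / 4 * E = c / 8 * (2 * E))%R); last by field.
  by apply: ler_wpM2l => //; rewrite divr_ge0// ltW.
rewrite !mulr_sumr -big_split /= big_seq [leRHS]big_seq; apply: ler_sum => x xL.
set T := ((tau L v A x)%:R : R).
(* At distance 0 the square below cannot be completed, but there d itself is 0. *)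
have [T0|T0] := eqVneq T 0%R.
  have -> : d x = 0%R.
    apply: (agree_pinned _ _ _ _ a1 a2); have := pinned_tau L v v0 A x xL.
    by move/eqP: T0; rewrite /T pnatr_eq0 => /eqP ->; rewrite ray0.
  by rewrite T0 !expr0n /= !(mulr0, mul0r) addr0.
have Tp : (0 < T)%R by rewrite lt0r T0 ler0n.
rewrite -subr_ge0.
have -> : (t ^+ 2 * (2 / c * (alpha x ^+ 2 * T ^+ 3)) + c / 8 * (d x ^+ 2 / T ^+ 3) - t * (alpha x * d x)
  = (4 * t * alpha x * T ^+ 3 - c * d x) ^+ 2 / (8 * c * T ^+ 3))%R.
  by field; rewrite T0 gt_eqF.
by rewrite divr_ge0 ?sqr_ge0// !mulr_ge0 ?exprn_ge0// ltW.
Qed.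

(* Prekopa-Leindler for e^(tX) w, e^(-tX) w and w: the strict convexity of the
   energy absorbs t (X h1 - X h2) up to the constant 1, and the first two
   integrals agree by the symmetry h -> - h. *)
Lemma pinned_exp_moment L A alpha (t : R) :
  (t ^+ 2 * (2 / c * \sum_(x <- Lambda L) alpha x ^+ 2 * (tau L v A x)%:R ^+ 3) <= 1)%R ->
  pint (Lambda L) A (fun h => (expR (t * pairing L alpha h) * w L h)%:E) zeroc <=
    (expR 2^-1)%:E * pinned_partition L A.
Proof.
move=> ht.
have mX s d (T : measurableType d) (k : site -> T -> R) : (forall j, measurable_fun setT (k j)) ->
    measurable_fun setT (fun u => expR (s * pairing L alpha (k ^~ u)))%R.
  move=> mk; apply: measurableT_comp; first exact: measurable_expR.
  by apply: measurable_funM => //; exact: measurable_pairing.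
pose F s h := (expR (s * pairing L alpha h) * w L h)%:E.
have nF s : nice (F s) by apply: nice_gibbs => d T k; exact: mX.
have F0 s h : 0 <= F s h by rewrite lee_fin mulr_ge0 ?expR_ge0.
have nw := nice_weight L.
(* [M] enters squared, so the factor exp(1/2) pays for the constant 1 of [pairing_le_energy]. *)
pose M h := (expR 2^-1)%:E * (w L h)%:E.
have nM : nice M.
  by move=> d T k mk; apply: measurable_funeM; exact: nw.
have M0 h : 0 <= M h by rewrite mule_ge0 ?lee_fin ?expR_ge0.
have FN : pint (Lambda L) A (F (- t)%R) zeroc = pint (Lambda L) A (F t) zeroc.
  rewrite -{2}zeroc_oppc -(pint_oppc _ _ (F t))//; congr pint; apply/funext => h /=.
  rewrite /F /gibbs_weight hamiltonian_oppc; congr (expR _ * _)%:E.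
  rewrite mulNr -mulrN; congr (_ * _)%R; rewrite /pairing -sumrN.
  by apply: eq_bigr => x _; rewrite /oppc mulrN.
have := pint_prekopa_leindler (Lambda L) A (F t) (F (- t)%R) M zeroc zeroc
  (nF _) (nF _) nM (F0 _) (F0 _) M0.
rewrite FN zeroc_midc {2 3}/M pintZ//; last exact: weight_ge0.
move=> h; apply: mul_le_sqr_ereal.
- exact: (pint_ge0 _ _ (F t) _ (F0 t)).
- by rewrite mule_ge0 ?lee_fin ?expR_ge0//; apply: pint_ge0; exact: weight_ge0.
apply: h => h1 h2 a1 a2; rewrite /F /M -!EFinM lee_fin.
have wm := weight_midpoint L h1 h2.
have := pairing_le_energy L A alpha t h1 h2 a1 a2 ht.
set E := (c / 4 * _)%R in wm *; set X1 := pairing _ _ h1; set X2 := pairing _ _ h2 => hE.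
rewrite mulrACA -expRD; apply: (@le_trans _ _ (expR (1 + E) * (w L (midc h1 h2) ^+ 2 * expR (- E)))%R).
  apply: ler_pM => //; rewrite ?mulr_ge0 ?expR_ge0// ler_expR; lra.
have -> : expR (1 + E) = (expR 2^-1 * expR 2^-1 * expR E)%R.
  by rewrite -!expRD; congr expR; field.
have EE : (expR E * expR (- E) = 1)%R by rewrite -expRD subrr expR0.
rewrite le_eqVlt; apply/orP; left; apply/eqP.
rewrite -[RHS]mulr1 -EE; ring.
Qed.

Lemma sqr_le_expR (x : R) : (x ^+ 2 <= 2 * (expR x + expR (- x)))%R.
Proof.
wlog x0 : x / (0 <= x)%R => [H|].
  have [|/ltW xn] := leP 0%R x; first exact: H.
  by have := H (- x)%R; rewrite oppr_ge0 opprK sqrrN [(expR (- x) + _)%R]addrC; apply.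
have := expR_ge1Dxn 1 x0; have := expR_ge0 (- x)%R.
rewrite (_ : 2`!%:R = 2%R)//; lra.
Qed.

(** Integrate (tX)^2 <= 2 (e^(tX) + e^(-tX)); the condition on t is even, so [pinned_exp_moment]
    bounds both exponentials. *)
Lemma pinned_second_moment L A alpha (t : R) :
  (t ^+ 2 * (2 / c * \sum_(x <- Lambda L) alpha x ^+ 2 * (tau L v A x)%:R ^+ 3) <= 1)%R ->
  (t ^+ 2)%:E * pint (Lambda L) A (fun h => (pairing L alpha h ^+ 2 * w L h)%:E) zeroc <=
    (4 * expR 2^-1)%:E * pinned_partition L A.
Proof.
move=> ht.
have mX s d (T : measurableType d) (k : site -> T -> R) : (forall j, measurable_fun setT (k j)) ->
    measurable_fun setT (fun u => expR (s * pairing L alpha (k ^~ u)))%R.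
  move=> mk; apply: measurableT_comp; first exact: measurable_expR.
  by apply: measurable_funM => //; exact: measurable_pairing.
pose F s h := (expR (s * pairing L alpha h) * w L h)%:E.
have nF s : nice (F s) by apply: nice_gibbs => d T k; exact: mX.
have F0 s h : 0 <= F s h by rewrite lee_fin mulr_ge0 ?expR_ge0.
pose S h := (pairing L alpha h ^+ 2 * w L h)%:E.
have nS : nice S.
  apply: nice_gibbs => d T k mk; apply: measurable_funX; exact: measurable_pairing.
have S0 h : 0 <= S h by rewrite lee_fin mulr_ge0 ?expR_ge0 ?sqr_ge0.
rewrite -pintZ// ?sqr_ge0//.
apply: (@le_trans _ _ (pint (Lambda L) A (fun h => 2%:E * (F t h + F (- t)%R h)) zeroc)).
  apply: le_pint => //.
  - by move=> d T k mk; apply: measurable_funeM; exact: nS.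
  - move=> d T k mk; apply: measurable_funeM; apply: emeasurable_funD; exact: nF.
  - by move=> h; apply: mule_ge0; [rewrite lee_fin sqr_ge0|exact: S0].
  - by move=> h; apply: mule_ge0; [rewrite lee_fin|apply: adde_ge0].
  move=> h _; rewrite /S /F -EFinD -!EFinM lee_fin mulrA -exprMn -mulrDl mulrA.
  by apply: ler_wpM2r; [exact: expR_ge0|rewrite mulNr; exact: sqr_le_expR].
rewrite (pintZ _ _ (fun h => F t h + F (- t)%R h))//; last 2 first.
- by move=> d T k mk; apply: emeasurable_funD; exact: nF.
- by move=> h; rewrite adde_ge0.
rewrite pintD// (_ : (4 * expR 2^-1)%R = (2 * (expR 2^-1 + expR 2^-1))%R); last by ring.
rewrite EFinM -muleA; apply: lee_wpmul2l; first by rewrite lee_fin.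
rewrite EFinD ge0_muleDl ?lee_fin ?expR_ge0//; apply: leeD; apply: pinned_exp_moment => //.
by rewrite sqrrN.
Qed.
End PinnedGibbs.

(** * The price of one more pin *)

Section PinCost.
Context {R : realType}.
Variables (r : nat) (Psi : site -> R -> R) (c : R) (v : site).
Hypothesis HPsi : Psi_hyp r Psi.
Hypothesis c0 : (0 < c)%R.
Hypothesis v0 : site_lt (0, 0)%R v.
Hypothesis Hv : Pc_step Psi c v.
Local Notation mu := (@lebesgue_measure R).
Local Notation w L := (gibbs_weight Psi r L).
Local Notation zeroc := ((fun=> 0%R) : site -> R).
Local Notation Z L A := (pinned_partition r Psi L A).
Implicit Types h : site -> R.

Lemma gaussian_integral (a : R) : (0 < a)%R ->
  \int[mu]_x (expR (- (x ^+ 2 / (2 * a))))%:E = (Num.sqrt (2 * pi * a))%:E.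
Proof.
move=> a0; pose s := Num.sqrt a.
have s0 : s != 0%R by rewrite gt_eqF// sqrtr_gt0.
have s2 : (s ^+ 2 = a)%R by rewrite sqr_sqrtr// ltW.
have p0 := normal_peak_gt0 s0.
have E x : (normal_pdf 0 s x = normal_peak s * expR (- (x ^+ 2 / (2 * a))))%R.
  rewrite normal_pdfE// /normal_fun subr0 s2 mulNr; congr (_ * expR (- (_ / _)))%R; ring.
have := integral_normal_pdf 0 s.
under eq_integral do rewrite E EFinM.
rewrite ge0_integralZl_EFin//; last 2 first.
- apply/measurable_EFinP; apply: measurableT_comp; first exact: measurable_expR.
  by apply: measurable_funN; apply: measurable_funM => //; apply: measurable_funX.
- exact: ltW.
have -> : normal_peak s = ((Num.sqrt (2 * pi * a))^-1)%R.
  rewrite /normal_peak s2; congr (Num.sqrt _)^-1%R; ring.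
set I := \int[mu]_x _; set q := Num.sqrt _.
have q0 : (0 < q)%R by rewrite sqrtr_gt0 !mulr_gt0 ?pi_gt0.
move=> h; rewrite -[I]mul1e -[1]/(1%:E) -(divff (lt0r_neq0 q0)) EFinM -muleA h mule1 //.
Qed.

(* Prekopa-Leindler applied to the heights t and -t at y shows that the marginal
   density of h_y is at most its value at 0 times exp(- c t^2 / (2 n)). *)
Lemma pin_cost L A y n : y \in Lambda L -> y \notin A -> (0 < n)%N ->
  pinned L A (ray v y n) -> (forall k, (k < n)%N -> ray v y k \in Lambda L) ->
  Z L A <= (Num.sqrt (2 * pi * (n%:R / c)))%:E * Z L (y |` A)%fset.
Proof.
move=> yL yA n0 pn bn.
have nw := nice_weight r Psi HPsi L.
have w0 h : 0 <= (w L h)%:E by rewrite lee_fin expR_ge0.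
have n0R : (0 < n%:R :> R)%R by rewrite ltr0n.
have yn : ray v y n != y.
  rewrite -{2}(ray0 v y); apply/eqP => /ray_injr E; move: n0.
  rewrite E//; apply/eqP => E'; move: v0; by rewrite E' /site_lt /= ltxx.
have [s1 [s2 LE]] : exists s1 s2, Lambda L = s1 ++ y :: s2.
  by case/splitPr: yL => s1 s2; exists s1, s2.
have := uniq_Lambda L; rewrite LE cat_uniq /= negb_or => /and3P[_ /andP[ys1 _] /andP[ys2 _]].
set s := s1 ++ s2.
have ys : y \notin s by rewrite mem_cat negb_or ys1.
have Ls x : (x \in Lambda L) = (x == y) || (x \in s).
  by rewrite LE !mem_cat inE orbCA.
pose W := fun h => (w L h)%:E.
rewrite /pinned_partition -/W LE !pint_move//.
rewrite /= (negbTE yA) fset1U1 -/s.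
rewrite (pint_eq_pins s (y |` A)%fset A); last first.
  by move=> x xs; rewrite in_fset1U; case: eqVneq xs ys => [->->|].
(* The unnormalised density of the height at [y]: its integral is the left-hand side, and [phi 0] is
   the partition function with [y] pinned. *)
pose phi t := pint s A W (upd zeroc y t).
have phi0 t : 0 <= phi t by exact: pint_ge0.
have mphi : measurable_fun (setT : set (measurableTypeR R)) phi.
  by apply: nice_upd1; exact: nice_pint.
have phiN t : phi (- t)%R = phi t.
  rewrite /phi -{1}(zeroc_oppc (R := R)) -oppc_upd -(pint_oppc _ _ W)//.
  by congr pint; apply/funext => h /=; rewrite /W /gibbs_weight (hamiltonian_oppc r Psi HPsi).
have bound t : phi t <= (expR (- (t ^+ 2 / (2 * (n%:R / c)))))%:E * phi 0%R.
  set e := expR _.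
  have e0 : (0 <= e)%R by exact: expR_ge0.
  pose M h := e%:E * W h.
  have nM : nice M by move=> d T k mk; apply: measurable_funeM; exact: nw.
  have M0 h : 0 <= M h by apply: mule_ge0; [rewrite lee_fin|exact: w0].
  have := pint_prekopa_leindler s A W W M (upd zeroc y t) (upd zeroc y (- t)%R) nw nw nM w0 w0 M0.
  rewrite midc_upd subrr mul0r (zeroc_midc (R := R)) -/(phi t) -/(phi (- t)%R) phiN.
  rewrite {2 3}/M pintZ// -/(phi 0%R) => PL.
  apply: mul_le_sqr_ereal => //; first by rewrite mule_ge0 ?lee_fin.
  apply: PL => h1 h2 [a1 b1] [a2 b2]; rewrite /W /M -!EFinM lee_fin.
  apply: (le_trans (weight_midpoint r Psi c v HPsi c0 v0 Hv L h1 h2)).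
  have h1y : h1 y = t by rewrite a1// /upd eqxx.
  have h2y : h2 y = (- t)%R by rewrite a2// /upd eqxx.
  have dn : diffc L h1 h2 (ray v y n) = 0%R.
    rewrite /diffc; move: pn; rewrite /pinned Ls (negbTE yn) /=; case: ifP => // ns nA.
    by rewrite b1// b2// subrr.
  (* The difference of the two configurations is 2t at [y] and 0 after n steps, so its energy is at
     least 4 t^2 / n. *)
  have := sqr_le_energy L v v0 _ y n dn bn.
  rewrite {1}/diffc yL h1y h2y; set E := energy _ _ _ => tE.
  rewrite (_ : e * w L (midc h1 h2) * (e * w L (midc h1 h2)) =
    w L (midc h1 h2) ^+ 2 * (e * e))%R; last by ring.
  apply: ler_wpM2l; first exact: sqr_ge0.
  rewrite /e -expRD ler_expR.
  rewrite (_ : - (t ^+ 2 / (2 * (n%:R / c))) - t ^+ 2 / (2 * (n%:R / c)) =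
    - (c / 4 * ((t - - t) ^+ 2 / n%:R)))%R; last first.
    by field; rewrite !gt_eqF.
  rewrite lerN2; apply: ler_wpM2l; first by rewrite divr_ge0// ltW.
  by rewrite ler_pdivrMr// mulrC.
rewrite -/(phi 0%R).
apply: (@le_trans _ _ (\int[mu]_t ((expR (- (t ^+ 2 / (2 * (n%:R / c)))))%:E * phi 0%R))).
  have me : measurable_fun setT (fun t : R => (expR (- (t ^+ 2 / (2 * (n%:R / c)))))%:E).
    apply/measurable_EFinP; apply: measurableT_comp; first exact: measurable_expR.
    by apply: measurable_funN; apply: measurable_funM => //; apply: measurable_funX.
  have mr : measurable_fun (setT : set (measurableTypeR R))
      (fun t => (expR (- (t ^+ 2 / (2 * (n%:R / c)))))%:E * phi 0%R).
    rewrite (_ : (fun t => _) = (fun t : R => phi 0%R * (expR (- (t ^+ 2 / (2 * (n%:R / c)))))%:E)).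
      exact: measurable_funeM.
    by apply/funext => t; rewrite muleC.
  by apply: ge0_le_integral => // t _; [exact: phi0|exact: bound].
rewrite ge0_integralZr//.
- by rewrite gaussian_integral// divr_gt0.
- apply/measurable_EFinP; apply: measurableT_comp; first exact: measurable_expR.
  by apply: measurable_funN; apply: measurable_funM => //; apply: measurable_funX.
Qed.

Lemma pinned_partition_ge0 L A : 0 <= Z L A.
Proof. by apply: pint_ge0 => h; rewrite lee_fin expR_ge0. Qed.

Lemma pint_all_pinned (s : seq site) A (F : (site -> R) -> \bar R) :
  {subset s <= A} -> pint s A F zeroc = F zeroc.
Proof.
elim: s => [|i s IH] //= sA.
rewrite sA ?inE ?eqxx// (_ : upd zeroc i 0%R = zeroc).
  by apply: IH => j js; apply: sA; rewrite inE js orbT.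
by apply/funext => j; rewrite /upd if_same.
Qed.

Lemma in_fset_seq (s : seq site) x : (x \in [fset y in s]%fset) = (x \in s).
Proof. by rewrite inE. Qed.

Lemma pinned_partition_all L : Z L [fset x in Lambda L]%fset = (w L zeroc)%:E.
Proof. by apply: pint_all_pinned => x xL; rewrite in_fset_seq. Qed.

(** Pin the free sites one after another: each costs a finite factor by [pin_cost], and once all are
    pinned only the weight of the zero configuration is left. *)
Lemma pinned_partition_lty L A : (A `<=` [fset x in Lambda L])%fset -> Z L A < +oo.
Proof.
set S := [fset x in Lambda L]%fset.
have [k] := ubnP #|` (S `\` A)%fset|; elim: k A => // k IH A; rewrite ltnS => Sk AS.
have [|[y]] := fset_0Vmem (S `\` A)%fset.
  move=> /eqP; rewrite fsetD_eq0 => SA.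
  have -> : A = S by apply/eqP; rewrite eqEfsubset AS.
  by rewrite pinned_partition_all ltry.
rewrite in_fsetD in_fset_seq => /andP[yA yL].
pose n := tau L v A y.
have n0 : (0 < n)%N.
  rewrite lt0n; apply/eqP => E; have := pinned_tau L v v0 A y yL.
  by rewrite -/n E ray0 /pinned yL (negbTE yA).
apply: (le_lt_trans (pin_cost L A y n yL yA n0 (pinned_tau _ _ v0 _ _ yL) _)).
  by move=> j jn; apply: (before_tau_mem L v v0 A).
rewrite lte_mul_pinfty ?lee_fin ?sqrtr_ge0//; apply: IH.
- apply: leq_trans Sk; apply: fproper_ltn_card; rewrite fproperE; apply/andP; split.
    by apply: fsetDS; exact: fsubsetU1.
  apply/negP => /fsubsetP/(_ y); rewrite !in_fsetD in_fset1U eqxx in_fset_seq yA yL.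
  by move=> /(_ isT).
- by rewrite fsubUset AS andbT fsub1set in_fset_seq.
Qed.

End PinCost.

(** * Rarity of long gaps *)

Section PinGaps.
Local Open Scope ring_scope.
Context {R : realType}.
Variables (L : nat) (v : site) (W : {fset site} -> R) (K : R) (m : nat).
Hypothesis v0 : site_lt (0, 0) v.
Hypothesis W0 : forall A, 0 <= W A.
Hypothesis K0 : 0 <= K.
Hypothesis m0 : (0 < m)%N.
Hypothesis Km : 16 * K <= Num.sqrt m%:R.
Local Notation S := [fset x in Lambda L]%fset.
Hypothesis cost : forall A y n, (A `<=` S)%fset -> y \in Lambda L -> y \notin A ->
  (0 < n)%N -> pinned L A (ray v y n) ->
  (forall k, (k < n)%N -> ray v y k \in Lambda L) ->
  W A <= K * Num.sqrt n%:R * W (y |` A)%fset.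
Local Notation tau := (tau L v).

Section Site.
Variable x : site.
Hypothesis xL : x \in Lambda L.

(** The new pin is j + 1 steps before the end of the gap, so j = 0 is the last free site. *)
Let pin_at (A : {fset site}) (j : nat) : {fset site} :=
  (ray v x (tau A x - j.+1) |` A)%fset.

Lemma new_pin_free A j : (j < tau A x)%N -> ~~ pinned L A (ray v x (tau A x - j.+1)).
Proof. by move=> jt; apply: (before_tau L v v0 A) => //; lia. Qed.

Lemma tau_pin_at A j : (j < tau A x)%N -> tau (pin_at A j) x = (tau A x - j.+1)%N.
Proof.
move=> jt; apply: (tau_eq L v v0) => //.
  by rewrite /pinned /pin_at in_fset1U eqxx orbT.
move=> k kt; have kt' : (k < tau A x)%N by lia.
have := before_tau L v v0 A x k xL kt'.
rewrite /pinned /pin_at in_fset1U !negb_or => /andP[-> ->]; rewrite andbT /=.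
have vn : v != (0, 0) by apply/eqP => E; move: v0; rewrite E /site_lt /= ltxx.
by apply/eqP => /(ray_injr v x vn); lia.
Qed.

(** The shift by m keeps the ratio of cubes bounded when a pin shortens a gap, even to length 0. *)
Let g A : R := W A * ((tau A x)%:R + m%:R) ^+ 3.

Let g_ge0 A : 0 <= g A.
Proof. by rewrite mulr_ge0// exprn_ge0. Qed.

(** The pin costs K sqrt(j + 1) <= K sqrt(m). Since j + 1 <= m <= tau, shortening at most halves tau
    + m, whence 8 = 2^3. *)
Lemma pin_at_gain A j : (A `<=` S)%fset -> (m <= tau A x)%N -> (j < m)%N ->
  g A <= 8 * K * Num.sqrt m%:R * g (pin_at A j).
Proof.
move=> AS mt jm; have jt : (j < tau A x)%N by exact: leq_trans mt.
have := new_pin_free A j jt; rewrite /pinned negb_or negbK => /andP[yL yA].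
have h1 : W A <= K * Num.sqrt m%:R * W (pin_at A j).
  have ry k : ray v (ray v x (tau A x - j.+1)) k = ray v x (tau A x - j.+1 + k).
    exact: rayD.
  have := cost A _ j.+1 AS yL yA (ltn0Sn j).
  rewrite ry subnK// => /(_ (pinned_tau L v v0 A x xL)) h.
  apply: (le_trans (h _)).
    move=> k kj; rewrite ry; apply: (before_tau_mem L v v0 A) => //; lia.
  apply: ler_wpM2r => //; apply: ler_wpM2l => //.
  by rewrite ler_sqrt ?ler0n// ler_nat.
rewrite /g tau_pin_at//.
have h2 : ((tau A x)%:R + m%:R) ^+ 3 <= 8 * ((tau A x - j.+1)%:R + m%:R) ^+ 3 :> R.
  rewrite (_ : 8 = 2 ^+ 3); last by ring.
  rewrite -exprMn; apply: lerXn2r; rewrite ?nnegrE ?mulr_ge0 ?addr_ge0//.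
  by rewrite -!natrD -natrM ler_nat; lia.
apply: (le_trans (ler_pM _ _ h1 h2)) => //.
by rewrite le_eqVlt; apply/orP; left; apply/eqP; ring.
Qed.

Let T := fpowerset S.

(* A is recovered from pin_at A j by removing the first pin seen from x. *)
Lemma pin_at_inj : {in [seq (A, j) | A <- [seq A : {fset site} <- T | (m <= tau A x)%N], j <- iota 0 m] &,
  injective (fun p => pin_at p.1 p.2)}.
Proof.
move=> _ _ /allpairsP[[A j] /= [+ + ->]] /allpairsP[[B k] /= [+ + ->]] /=.
rewrite !mem_filter !mem_iota !add0n /= => /andP[mA _] jm /andP[mB _] km E.
have jA : (j < tau A x)%N by exact: leq_trans mA.
have kB : (k < tau B x)%N by exact: leq_trans mB.
have tE : (tau A x - j.+1 = tau B x - k.+1)%N by rewrite -!tau_pin_at// E.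
have := new_pin_free A j jA; have := new_pin_free B k kB.
rewrite /pinned !negb_or tE => /andP[_ yB] /andP[_ yA].
have AB : A = B.
  move: E; rewrite /pin_at tE => /(congr1 (fun C => C `\ ray v x (tau B x - k.+1))%fset).
  by rewrite !fsetU1K.
by rewrite AB in tE jA *; congr pair; lia.
Qed.

(* A gap of length at least m can be shortened by one pin at any of the m sites
   preceding its end. Each such pin costs at most K sqrt(m), so the m choices
   win over the cost once m is large. *)
Lemma mean_cubed_gap_le :
  \sum_(A <- T) W A * ((tau A x)%:R + m%:R) ^+ 3 <= 16 * m%:R ^+ 3 * \sum_(A <- T) W A.
Proof.
have m0R : 0 < m%:R :> R by rewrite ltr0n.
have s0 : 0 < Num.sqrt m%:R :> R by rewrite sqrtr_gt0.
have ss : Num.sqrt m%:R * Num.sqrt m%:R = m%:R :> R by rewrite -expr2 sqr_sqrtr// ltW.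
rewrite -/(\sum_(A <- T) g A); set M := \sum_(A <- T) g A.
have M0 : 0 <= M by apply: sumr_ge0.
pose B := \sum_(A <- T | (m <= tau A x)%N) g A.
have hB : m%:R * B <= 8 * K * Num.sqrt m%:R * M.
  apply: (@le_trans _ _ (\sum_(A <- T | (m <= tau A x)%N) \sum_(j <- iota 0 m)
      8 * K * Num.sqrt m%:R * g (pin_at A j))).
    rewrite mulr_sumr big_seq_cond [leRHS]big_seq_cond; apply: ler_sum => A.
    rewrite fpowersetE => /andP[AS mt].
    have -> : m%:R * g A = \sum_(j <- iota 0 m) g A.
      by rewrite big_const_seq count_predT size_iota iter_addr_0 mulr_natl.
    rewrite big_seq [leRHS]big_seq; apply: ler_sum => j; rewrite mem_iota add0n /= => jm.
    exact: pin_at_gain.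
  under eq_bigr do rewrite -mulr_sumr.
  rewrite -mulr_sumr; apply: ler_wpM2l; first by rewrite !mulr_ge0.
  rewrite -big_filter.
  pose r1 := [seq (A, j) | A <- [seq A : {fset site} <- T | (m <= tau A x)%N], j <- iota 0 m].
  rewrite [leLHS](_ : _ = \sum_(p <- r1) g (pin_at p.1 p.2)); last by rewrite big_allpairs.
  apply: (ler_sum_inj _ _ _ _ (fun p => pin_at p.1 p.2) g) => //.
  - apply: allpairs_uniq; rewrite ?iota_uniq ?filter_uniq ?fset_uniq//.
    by move=> [? ?] [? ?].
  - exact: fset_uniq.
  - exact: pin_at_inj.
  - move=> _ /allpairsP[[A j] /= [+ + ->]] /=.
    rewrite mem_filter mem_iota add0n /= => /andP[mA AT] jm.
    have jA : (j < tau A x)%N by exact: leq_trans mA.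
    have := new_pin_free A j jA; rewrite /pinned negb_or negbK => /andP[yL _].
    move: AT; rewrite !fpowersetE /pin_at fsubUset => ->; rewrite andbT.
    by rewrite fsub1set in_fset_seq.
(* By 16 K <= sqrt(m), the bound 8 K sqrt(m) M on m B is at most m M / 2. *)
have hB2 : 2 * B <= M.
  rewrite -(ler_pM2l m0R); apply: (@le_trans _ _ (2 * (8 * K * Num.sqrt m%:R * M))).
    by rewrite mulrCA ler_pM2l.
  rewrite [leRHS](_ : _ = Num.sqrt m%:R * (Num.sqrt m%:R * M)); last by rewrite mulrA ss.
  rewrite (_ : 2 * (8 * K * Num.sqrt m%:R * M) = (16 * K) * (Num.sqrt m%:R * M)); last by ring.
  by apply: ler_wpM2r => //; rewrite mulr_ge0// ltW.
(* Gaps shorter than m satisfy (tau + m)^3 <= (2m)^3. With B <= M / 2 this gives the factor 16. *)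
have hC : M - B <= 8 * m%:R ^+ 3 * \sum_(A <- T) W A.
  rewrite /M (bigID (fun A => m <= tau A x)%N) /= -/B addrAC subrr add0r mulr_sumr.
  apply: (@le_trans _ _ (\sum_(A <- T | ~~ (m <= tau A x)%N) 8 * m%:R ^+ 3 * W A)).
    apply: ler_sum => A; rewrite -ltnNge => tm.
    rewrite /g mulrC; apply: ler_wpM2r => //.
    rewrite (_ : 8 = 2 ^+ 3); last by ring.
    rewrite -exprMn; apply: lerXn2r; rewrite ?nnegrE ?mulr_ge0 ?addr_ge0//.
    by rewrite -!natrD -natrM ler_nat; lia.
  rewrite [leRHS](bigID (fun A => m <= tau A x)%N) /= lerDr.
  by apply: sumr_ge0 => A _; rewrite !mulr_ge0// exprn_ge0.
lra.
Qed.

End Site.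
End PinGaps.

(** * The variance bound *)

Section Iint.
Context {R : realType}.
Implicit Types (F G : (site -> R) -> \bar R).

Lemma iintZ J s F h (c : R) : nice F -> (forall h, 0 <= F h) -> (0 <= c)%R ->
  iint J s (fun h => c%:E * F h) h = c%:E * iint J s F h.
Proof.
move=> nF F0 c0; elim: s h => [|i s IH] h //=.
under eq_integral do rewrite IH.
rewrite ge0_integralZl_EFin//; first by move=> x _; apply: iint_ge0.
by apply: nice_upd1; apply: nice_iint.
Qed.

Lemma iintD J s F G h : nice F -> nice G -> (forall h, 0 <= F h) -> (forall h, 0 <= G h) ->
  iint J s (fun h => F h + G h) h = iint J s F h + iint J s G h.
Proof.
move=> nF nG F0 G0; elim: s h => [|i s IH] h //=.
under eq_integral do rewrite IH.
by rewrite ge0_integralD//; try (by move=> x _; apply: iint_ge0);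
  apply: nice_upd1; apply: nice_iint.
Qed.

Lemma iint_cst0 J s h : iint J s (fun=> 0) h = 0 :> \bar R.
Proof.
by elim: s h => [|i s IH] h //=; apply: integral0_eq => x _; exact: IH.
Qed.
End Iint.

Section Variance.
Context {R : realType}.
Variables (r : nat) (Psi : site -> R -> R) (J : R) (L : nat) (alpha : site -> R).
Hypothesis HPsi : Psi_hyp r Psi.
Local Notation w := (gibbs_weight Psi r L).
Local Notation X := (pairing L alpha).

(** From |E X| <= sigma and (X - m)^2 <= 2 X^2 + 2 m^2. Only nonnegative integrands are ever added,
    so integrability of X is not a separate concern. *)
Lemma gibbs_var_pairing_le (z sigma : R) :
  (0 < z)%R -> (0 < sigma)%R -> partition_fn Psi r J L = z%:E ->
  lam_int J L (fun h => (X h ^+ 2 * w h)%:E) <= (sigma ^+ 2 * z)%:E ->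
  gibbs_var Psi r J L X <= (4 * sigma ^+ 2)%:E.
Proof.
move=> z0 s0 Zz N2.
have Zinv : (partition_fn Psi r J L)^-1 = (z^-1)%:E by rewrite Zz inver gt_eqF.
pose N := fun h => (X h ^+ 2 * w h)%:E; pose W := fun h => (w h)%:E.
have mX d (T : measurableType d) (k : site -> T -> R) : (forall j, measurable_fun setT (k j)) ->
    measurable_fun setT (fun t => X (k ^~ t)) by exact: measurable_pairing.
have nN : nice N by apply: (nice_gibbs r Psi HPsi) => d T k mk; apply: measurable_funX; exact: mX.
have nW : nice W by exact: nice_weight.
have N0 h : 0 <= N h by rewrite lee_fin mulr_ge0 ?sqr_ge0 ?expR_ge0.
have W0 h : 0 <= W h by rewrite lee_fin expR_ge0.
have nZ a F : nice F -> nice (fun h => a%:E * F h).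
  by move=> nF d T k mk; apply: measurable_funeM; exact: nF.
have Z0 (a : R) F : (0 <= a)%R -> (forall h, 0 <= F h) -> forall h : site -> R, 0 <= a%:E * F h.
  by move=> a0 F0 h; apply: mule_ge0; [rewrite lee_fin|].
(* Both the mean and the variance are controlled through a^2 X^2 + b^2. *)
have comb (a b : R) : (0 <= a)%R -> (0 <= b)%R ->
    lam_int J L (fun h => a%:E * N h + b%:E * W h) <= ((a * sigma ^+ 2 + b) * z)%:E.
  move=> a0 b0; rewrite /lam_int iintD ?iintZ; try solve [exact: nZ|exact: Z0|exact: nN|exact: nW|by []].
  rewrite -[iint _ _ W _]/(partition_fn Psi r J L) Zz.
  apply: (@le_trans _ _ (a%:E * (sigma ^+ 2 * z)%:E + b%:E * z%:E)).
    by apply: leeD2r; apply: lee_wpmul2l; rewrite ?lee_fin.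
  by rewrite -!EFinM -EFinD lee_fin mulrDl mulrA.
set m := fine (gibbs_expect Psi r J L X).
have m_le : (`|m| <= sigma)%R.
  rewrite /m /gibbs_expect Zinv.
  have nX : nice (fun h => (X h * w h)%:E) by exact: (nice_gibbs r Psi HPsi).
  have h1 : `|lam_int J L (fun h => (X h * w h)%:E)| <= (sigma * z)%:E.
    apply: (le_trans (le_abse_iint _ _ _ _ nX)).
    (* Cauchy-Schwarz for the mean in linear form: |X| <= X^2 / (2 sigma) + sigma / 2. *)
    apply: (@le_trans _ _ (lam_int J L (fun h => (2^-1 / sigma)%:E * N h + (sigma / 2)%:E * W h))).
      apply: le_iint => //.
      - by move=> d T k mk; apply: measurableT_comp => //; exact: nX.
      - by move=> d T k mk; apply: emeasurable_funD; apply: nZ.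
      - by move=> h; exact: abse_ge0.
      - move=> h; rewrite /N /W /= -!EFinM -EFinD lee_fin normrM (ger0_norm (expR_ge0 _)).
        rewrite mulrA -mulrDl; apply: ler_wpM2r; first exact: expR_ge0.
        rewrite -(real_normK (num_real (X h))) -subr_ge0; set u := (`|X h|)%R.
        rewrite (_ : _ - u = (u - sigma) ^+ 2 / (2 * sigma))%R; last by field; rewrite gt_eqF.
        by rewrite divr_ge0 ?sqr_ge0// mulr_ge0// ltW.
    apply: (le_trans (comb _ _ _ _)); rewrite ?divr_ge0 ?invr_ge0 ?(ltW s0)//.
    rewrite lee_fin ler_pM2r// le_eqVlt; apply/orP; left; apply/eqP; field; by rewrite gt_eqF.
  move: h1; case: (lam_int _ _ _) => [a| |] //=; rewrite ?lee_fin ?leye_eq// => h1.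
  by rewrite normrM (gtr0_norm (_ : 0 < z^-1)%R) ?invr_gt0// ler_pdivrMr.
rewrite /gibbs_var -/m {1}/gibbs_expect Zinv.
apply: (@le_trans _ _ ((((2 * sigma ^+ 2 + 2 * m ^+ 2) * z)%:E) * (z^-1)%:E)).
  apply: lee_wpmul2r; first by rewrite lee_fin invr_ge0 ltW.
  have mm : (0 <= 2 * m ^+ 2)%R by rewrite pmulr_rge0 ?sqr_ge0.
  apply: le_trans (comb _ _ (ler0n R 2) mm).
  apply: le_iint => //.
  - apply: (nice_gibbs r Psi HPsi) => d T k mk; apply: measurable_funX.
    by apply: measurable_funB => //; exact: mX.
  - by move=> d T k mk; apply: emeasurable_funD; apply: nZ.
  - by move=> h; rewrite lee_fin mulr_ge0 ?sqr_ge0 ?expR_ge0.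
  - move=> h; rewrite /N /W -!EFinM -EFinD lee_fin mulrA -mulrDl; apply: ler_wpM2r; first exact: expR_ge0.
    rewrite -subr_ge0 (_ : _ - _ = (X h + m) ^+ 2)%R ?sqr_ge0//; ring.
rewrite -EFinM lee_fin mulfK ?gt_eqF//.
have : (m ^+ 2 <= sigma ^+ 2)%R.
  by rewrite -(real_normK (num_real m)) ler_pXn2r ?nnegrE ?(ltW s0).
lra.
Qed.

(** Covers the degenerate case, as [gibbs_var_pairing_le] divides by sigma. *)
Lemma gibbs_var_pairing0 : (forall x, x \in Lambda L -> alpha x = 0%R) ->
  gibbs_var Psi r J L X = 0.
Proof.
move=> a0.
have X0 h : X h = 0%R.
  by rewrite /pairing big_seq big1// => x /a0 ->; rewrite mul0r.
have E0 (Y : (site -> R) -> R) : (forall h, Y h = 0%R) -> gibbs_expect Psi r J L Y = 0.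
  move=> Y0; rewrite /gibbs_expect (_ : (fun h => (Y h * w h)%:E) = fun=> 0).
    by rewrite /lam_int iint_cst0 mul0e.
  by apply/funext => h; rewrite Y0 mul0r.
by rewrite /gibbs_var (E0 X X0) /=; apply: (E0) => h; rewrite X0 subrr expr0n.
Qed.
End Variance.

(** A path from the origin to (1, 0) contains a nonzero step. Since Psi_j = Psi_{-j}, its opposite
    is also allowed, and one of the two is lexicographically positive. *)
Lemma strictly_convex_step (R : realType) (r : nat) (Psi : site -> R -> R) (c : R) :
  Psi_hyp r Psi -> Pc_irreducible Psi c ->
  exists v, site_lt (0, 0)%R v /\ Pc_step Psi c v.
Proof.
move=> [_ PsiN _ _ _] /(_ (1, 0)%R)[s [sc s1]].
have [j js j0] : exists2 j, j \in s & j != (0, 0)%R.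
  apply/hasP; apply: contraT; rewrite -all_predC => /allP s0.
  have : foldr site_add (0, 0)%R s = (0, 0)%R.
    elim: s s0 {sc s1} => [|k s IH] //= s0.
    have /= := s0 k (mem_head _ _); rewrite negbK => /eqP ->.
    by rewrite IH// => i si; apply: s0; rewrite inE si orbT.
  by rewrite s1.
have [jl|jl] := boolP (site_lt (0, 0)%R j); first by exists j; split => //; exact: sc.
exists (site_opp j); split.
  move: jl j0; case: j {js} => p q; rewrite /site_lt /site_opp xpair_eqE /=; lia.
have := sc j js; rewrite /Pc_step.
by rewrite (_ : Psi (site_opp j) = Psi j)//; apply/funext => x; rewrite -PsiN.
Qed.

(** * Averaging over the pinned sets *)

Section Assembly.
Context {R : realType}.
Variables (r : nat) (Psi : site -> R -> R) (J c : R) (v : site) (L : nat) (m : nat).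
Hypothesis HPsi : Psi_hyp r Psi.
Hypothesis c0 : (0 < c)%R.
Hypothesis v0 : site_lt (0, 0)%R v.
Hypothesis Hv : Pc_step Psi c v.
Hypothesis m0 : (0 < m)%N.
Hypothesis Km : (16 * (expR (- J) * Num.sqrt (2 * pi / c)) <= Num.sqrt m%:R)%R.
Local Notation S := [fset x in Lambda L]%fset.
Local Notation Z A := (pinned_partition r Psi L A).
Local Notation w := (gibbs_weight Psi r L).

(** The unnormalised probability that A is the pinned set; for A in the box, [fine] loses nothing by
    [pinned_partition_lty]. *)
Definition pin_weight (A : {fset site}) : R := (expR J ^+ #|` A| * fine (Z A))%R.

Lemma pin_weight_ge0 A : (0 <= pin_weight A)%R.
Proof.
by rewrite mulr_ge0 ?exprn_ge0 ?expR_ge0// fine_ge0// pinned_partition_ge0.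
Qed.

Lemma pin_weightE A : (A `<=` S)%fset ->
  (pin_weight A)%:E = (expR J ^+ #|` A|)%:E * Z A.
Proof.
move=> AS; rewrite /pin_weight EFinM fineK//.
by rewrite ge0_fin_numE ?pinned_partition_ge0// (pinned_partition_lty r Psi c v).
Qed.

(** The atom at the new pin contributes e^J, so the constant of [pin_cost] is multiplied by
    e^(-J). *)
Lemma pin_weight_cost A y n : (A `<=` S)%fset -> y \in Lambda L -> y \notin A ->
  (0 < n)%N -> pinned L A (ray v y n) ->
  (forall k, (k < n)%N -> ray v y k \in Lambda L) ->
  (pin_weight A <= expR (- J) * Num.sqrt (2 * pi / c) * Num.sqrt n%:R * pin_weight (y |` A)%fset)%R.
Proof.
move=> AS yL yA n0 pn bn.
have yAS : (y |` A `<=` S)%fset by rewrite fsubUset AS andbT fsub1set in_fset_seq.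
rewrite -lee_fin [leRHS]EFinM !pin_weightE//.
have := pin_cost r Psi c v HPsi c0 v0 Hv L A y n yL yA n0 pn bn.
rewrite cardfsU1 yA add1n exprS.
rewrite (_ : 2 * pi * (n%:R / c) = 2 * pi / c * n%:R)%R; last by ring.
rewrite sqrtrM ?divr_ge0 ?mulr_ge0 ?pi_ge0 ?(ltW c0)// => h.
apply: (le_trans (lee_wpmul2l _ h)); first by rewrite lee_fin exprn_ge0 ?expR_ge0.
rewrite !muleA -!EFinM le_eqVlt; apply/orP; left; apply/eqP; congr (_%:E * _).
have JJ : (expR (- J) * expR J = 1)%R by rewrite -expRD addNr expR0.
by rewrite -[LHS]mul1r -JJ; ring.
Qed.

Lemma partition_fnE : partition_fn Psi r J L = (\sum_(A <- fpowerset S) pin_weight A)%:E.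
Proof.
have w0 (h : site -> R) : 0 <= (w h)%:E by rewrite lee_fin expR_ge0.
rewrite /partition_fn /lam_int iint_pint//; [|exact: uniq_Lambda|exact: nice_weight].
rewrite -sumEFin big_seq [RHS]big_seq; apply: eq_bigr => A; rewrite fpowersetE => AS.
by rewrite pin_weightE.
Qed.

Lemma partition_sum_gt0 : (0 < \sum_(A <- fpowerset S) pin_weight A)%R.
Proof.
have SS : S \in fpowerset S by rewrite fpowersetE.
apply: (@lt_le_trans _ _ (pin_weight S)).
  rewrite -lte_fin pin_weightE// pinned_partition_all -EFinM lte_fin.
  by rewrite mulr_gt0 ?exprn_gt0 ?expR_gt0.
by apply: (le_sum_term _ _ xpredT pin_weight) => //; exact: pin_weight_ge0.
Qed.

Lemma second_moment_le (alpha : site -> R) :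
  (0 < \sum_(x <- Lambda L) alpha x ^+ 2)%R ->
  lam_int J L (fun h => (pairing L alpha h ^+ 2 * w h)%:E) <=
   (4 * expR 2^-1 * (2 / c) * (16 * m%:R ^+ 3) * (\sum_(x <- Lambda L) alpha x ^+ 2) *
     \sum_(A <- fpowerset S) pin_weight A)%:E.
Proof.
move=> a0; pose G A x : R := ((tau L v A x)%:R + m%:R)%R.
have m0R : (0 < m%:R :> R)%R by rewrite ltr0n.
have Gm A x : (m%:R <= G A x)%R by rewrite lerDr.
(* With tau + m in place of tau this is positive even when every site is pinned, and its mean is
   what [mean_cubed_gap_le] bounds. *)
pose SA A := (2 / c * \sum_(x <- Lambda L) alpha x ^+ 2 * G A x ^+ 3)%R.
have SA0 A : (0 < SA A)%R.
  rewrite mulr_gt0 ?divr_gt0//; apply: (@lt_le_trans _ _ (m%:R ^+ 3 * \sum_(x <- Lambda L) alpha x ^+ 2)%R).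
    by rewrite mulr_gt0 ?exprn_gt0.
  rewrite mulr_sumr; apply: ler_sum => x _; rewrite mulrC; apply: ler_wpM2l; first exact: sqr_ge0.
  by apply: lerXn2r; rewrite ?nnegrE ?addr_ge0.
have nN : nice (fun h => (pairing L alpha h ^+ 2 * w h)%:E).
  apply: (nice_gibbs r Psi HPsi) => d T k mk; apply: measurable_funX; exact: measurable_pairing.
have N0 (h : site -> R) : 0 <= (pairing L alpha h ^+ 2 * w h)%:E.
  by rewrite lee_fin mulr_ge0 ?sqr_ge0 ?expR_ge0.
rewrite /lam_int iint_pint//; last exact: uniq_Lambda.
apply: (@le_trans _ _ (\sum_(A <- fpowerset S) (4 * expR 2^-1 * (SA A * pin_weight A))%:E)).
  rewrite big_seq [leRHS]big_seq; apply: lee_sum => A; rewrite fpowersetE => AS.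
  set P := pint _ _ _ _.
  have P0 : 0 <= P by exact: pint_ge0.
  (* The scale depends on A: t^2 * SA A = 1, so the condition of [pinned_second_moment] holds
     because tau <= tau + m. *)
  pose t := (Num.sqrt (SA A))^-1%R.
  have t2 : (t ^+ 2 = (SA A)^-1)%R by rewrite exprVn sqr_sqrtr// ltW.
  have ht : (t ^+ 2 * (2 / c * \sum_(x <- Lambda L) alpha x ^+ 2 * (tau L v A x)%:R ^+ 3) <= 1)%R.
    rewrite t2 mulrC ler_pdivrMr// mul1r /SA; apply: ler_wpM2l; first by rewrite divr_ge0// ltW.
    apply: ler_sum => x _; apply: ler_wpM2l; first exact: sqr_ge0.
    by apply: lerXn2r; rewrite ?nnegrE ?addr_ge0// lerDl.
  have := pinned_second_moment r Psi c v HPsi c0 v0 Hv L A alpha t ht.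
  rewrite -/P t2 => h.
  have PE : P = (SA A)%:E * ((SA A)^-1%:E * P) by rewrite muleA -EFinM mulfV ?gt_eqF// mul1e.
  rewrite PE [(4 * expR _ * _)%R]mulrCA [leRHS]EFinM [(_ * pin_weight A)%:E]EFinM pin_weightE//.
  rewrite muleCA; apply: lee_wpmul2l; first by rewrite lee_fin ltW.
  rewrite [leRHS]muleCA; apply: lee_wpmul2l; first by rewrite lee_fin exprn_ge0 ?expR_ge0.
  exact: h.
rewrite sumEFin lee_fin -mulr_sumr.
have -> : (\sum_(A <- fpowerset S) SA A * pin_weight A =
    2 / c * \sum_(x <- Lambda L) alpha x ^+ 2 * \sum_(A <- fpowerset S) pin_weight A * G A x ^+ 3)%R.
  transitivity (\sum_(A <- fpowerset S) \sum_(x <- Lambda L)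
      2 / c * (alpha x ^+ 2 * (pin_weight A * G A x ^+ 3)))%R.
    apply: eq_bigr => A _; rewrite /SA mulr_sumr mulr_suml; apply: eq_bigr => x _; ring.
  rewrite exchange_big mulr_sumr /=; apply: eq_bigr => x _.
  by rewrite -mulr_sumr -mulr_sumr.
set V := (\sum_(A <- fpowerset S) pin_weight A)%R.
have key : (\sum_(x <- Lambda L) alpha x ^+ 2 * (\sum_(A <- fpowerset S) pin_weight A * G A x ^+ 3) <=
    (16 * m%:R ^+ 3 * V) * \sum_(x <- Lambda L) alpha x ^+ 2)%R.
  rewrite mulr_sumr big_seq [leRHS]big_seq; apply: ler_sum => x xL.
  rewrite mulrC; apply: ler_wpM2r; first exact: sqr_ge0.
  have K0 : (0 <= expR (- J) * Num.sqrt (2 * pi / c))%R.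
    by rewrite mulr_ge0 ?expR_ge0 ?sqrtr_ge0.
  exact: (mean_cubed_gap_le L v pin_weight _ m v0 pin_weight_ge0 K0 m0 Km pin_weight_cost x xL).
have ec : (0 <= 4 * expR 2^-1 * (2 / c) :> R)%R.
  by rewrite !mulr_ge0 ?expR_ge0 ?invr_ge0// ltW.
rewrite [leLHS]mulrA; apply: (le_trans (ler_wpM2l ec key)).
by rewrite le_eqVlt; apply/orP; left; apply/eqP; ring.
Qed.
End Assembly.

Local Open Scope ring_scope.

Theorem theorem2p5 (R : realType) (r : nat) (J c : R) :
  (1 <= r)%N -> 0 < c ->
  exists C5 : R,
    forall Psi : site -> R -> R,
      Psi_hyp r Psi -> Pc_irreducible Psi c ->
      forall (L : nat) (alpha : site -> R),
        (gibbs_var Psi r J L (pairing L alpha)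
          <= (C5 * \sum_(i <- Lambda L) alpha i ^+ 2)%:E)%E.
Proof.
move=> _ c0.
pose K : R := (16 * (expR (- J) * Num.sqrt (2 * pi / c)))%R.
have K0 : (0 <= K)%R by rewrite !mulr_ge0 ?expR_ge0 ?sqrtr_ge0.
(* The threshold is fixed from J and c before Psi, L and alpha appear, which makes the final
   constant uniform in them. *)
have [m m0 Km] : exists2 m : nat, (0 < m)%N & (K <= Num.sqrt m%:R)%R.
  have h : (0 <= K ^+ 2)%R by exact: sqr_ge0.
  have b := archi_boundP h.
  exists (Num.bound (K ^+ 2)).
    by rewrite -(ltr0n R); apply: le_lt_trans b.
  have KE : (K = Num.sqrt (K ^+ 2))%R by rewrite sqrtr_sqr ger0_norm.
  by rewrite {1}KE ler_sqrt ?ler0n// ltW.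
pose C2 : R := (4 * expR 2^-1 * (2 / c) * (16 * m%:R ^+ 3))%R.
have C20 : (0 < C2)%R.
  have e0 : (0 < expR (2^-1) :> R)%R by exact: expR_gt0.
  have mR : (0 < m%:R ^+ 3 :> R)%R by rewrite exprn_gt0 ?ltr0n.
  by rewrite /C2; apply: mulr_gt0; [apply: mulr_gt0; [exact: mulr_gt0|exact: divr_gt0]|exact: mulr_gt0].
(* [C2] is the constant of [second_moment_le]; the 4 comes from [gibbs_var_pairing_le]. *)
exists (4 * C2)%R => Psi HPsi Hirr L alpha.
have [v [v0 Hv]] := strictly_convex_step R r Psi c HPsi Hirr.
set q := (\sum_(i <- Lambda L) alpha i ^+ 2)%R.
have q0 : (0 <= q)%R by apply: sumr_ge0 => x _; exact: sqr_ge0.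
have [qz|qn] := eqVneq q 0%R.
  rewrite qz mulr0 gibbs_var_pairing0// => x xL; apply/eqP; rewrite -sqrf_eq0.
  rewrite eq_le sqr_ge0 andbT -qz.
  by apply: (le_sum_term _ _ xpredT (fun x => alpha x ^+ 2)%R) => // y; exact: sqr_ge0.
have qp : (0 < q)%R by rewrite lt0r qn.
pose sigma := Num.sqrt (C2 * q)%R.
have s2 : (sigma ^+ 2 = C2 * q)%R by rewrite sqr_sqrtr// ltW// mulr_gt0.
rewrite -mulrA -s2.
have := partition_sum_gt0 r Psi J c v L HPsi c0 v0 Hv.
have := partition_fnE r Psi J c v L HPsi c0 v0 Hv.
set z := (\sum_(A <- _) _)%R => Zz z0.
apply: (gibbs_var_pairing_le r Psi J L alpha HPsi z sigma z0 _ Zz).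
  by rewrite sqrtr_gt0 mulr_gt0.
rewrite s2; exact: (second_moment_le r Psi J c v L m HPsi c0 v0 Hv m0 Km).
Qed.
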